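(* Assume (A1)–(A3) and (A3h), and let $q\ge1$. Then the fully discrete scheme: find $U_h\in P_q(I_\tau;\mathcal V_h)\cap H^1(0,T;\mathcal V_h)$ and $P_h\in P_q(I_\tau;\mathcal Q_h)\cap H^1(0,T;\mathcal Q_h)$ such that $U_h(0)=\tilde u_h(0)$, $P_h(0)=\tilde p_h(0)$, and for $t>0$ $$a(U_h(t),v_h)-b(v_h,P_h(t))=\langle\Pi_q^1f(t),v_h\rangle\quad\forall v_h\in\mathcal V_h,$$ $$b(\dot U_h(t),q_h)+k(\Pi_{q-1}^0P_h(t),q_h)=\langle\Pi_{q-1}^0g(t),q_h\rangle\quad\forall q_h\in\mathcal Q_h,$$ has a unique solution, and the following energy identity is valid for $0\le n\le N$: $$\frac12a(U_h(t^n),U_h(t^n))+\int_0^{t^n}k(\Pi_{q-1}^0P_h(t),\Pi_{q-1}^0P_h(t))\,dt$$ $$=\frac12a(U_h(0),U_h(0))+\int_0^{t^n}\Big(\langle\Pi_q^1f(t),\dot U_h(t)\rangle+\langle\Pi_{q-1}^0g(t),P_h(t)\rangle\Big)dt.$$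
   Context: $\mathcal V,\mathcal Q,\mathcal Q_0$ are real Hilbert spaces with compact embedding $\mathcal Q\subset\mathcal Q_0$; identifying $\mathcal Q_0$ with its dual one has a Gelfand triple $\mathcal Q\subset\mathcal Q_0=\mathcal Q_0^*\subset\mathcal Q^*$. $\langle\cdot,\cdot\rangle$ denotes the duality products. The forms $a:\mathcal V\times\mathcal V\to\mathbb R$, $k:\mathcal Q\times\mathcal Q\to\mathbb R$, $b:\mathcal V\times\mathcal Q_0\to\mathbb R$ are bilinear. Assumptions: (A1) $a$ is bounded, elliptic and symmetric. (A2) $k$ is bounded, elliptic and symmetric. (A3) $b$ is bounded and inf-sup stable: there are $C_b,\beta>0$ with $b(v,q)\le C_b\|v\|_{\mathcal V}\|q\|_{\mathcal Q_0}$ and $\sup_{\|v\|_{\mathcal V}=1}b(v,q)\ge\beta\|q\|_{\mathcal Q_0}$ for all $v\in\mathcal V$, $q\in\mathcal Q_0$. (A3h) For the finite dimensional subspaces $\mathcal V_h\subset\mathcal V$, $\mathcal Q_h\subset\mathcal Q$ there is $\beta_h>0$ with $\sup_{v_h\in\mathcal V_h,\,\|v_h\|_{\mathcal V}=1}b(v_h,q_h)\ge\beta_h\|q_h\|_{\mathcal Q_0}$ for all $q_h\in\mathcal Q_h$. Norms: $\|v\|_{\mathcal V}^2=a(v,v)$, $\|q\|_{\mathcal Q}^2=k(q,q)$, and $\|q\|_{\mathcal Q_0}\le\|q\|_{\mathcal Q}$. A dot (or $\partial_t$) denotes the time derivative. Data: $f\in H^1(0,T;\mathcal V^* )$, $g\in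 L^2(0,T;\mathcal Q^* )$. Initial values: $p_0\in\mathcal Q$ is the initial pressure, and $u_0\in\mathcal V$ satisfies $a(u_0,v)-b(v,p_0)=\langle f(0),v\rangle$ for all $v\in\mathcal V$; $\tilde u_h(0)\in\mathcal V_h$, $\tilde p_h(0)\in\mathcal Q_h$ are their elliptic projections: $a(\tilde u_h(0)-u_0,v_h)-b(v_h,\tilde p_h(0)-p_0)=0$ for all $v_h\in\mathcal V_h$ and $k(\tilde p_h(0)-p_0,q_h)=0$ for all $q_h\in\mathcal Q_h$. Time grid: $I_\tau=\{0=t^0<t^1<\dots<t^N=T\}$; $P_q(I_\tau;X)$ is the space of functions whose restriction to each $[t^{n-1},t^n]$ is a polynomial of degree $\le q$ in $t$ with values in $X$. $\Pi_{q-1}^0:L^2(0,T;X)\to P_{q-1}(I_\tau;X)$ is the $L^2$-orthogonal projection. $\Pi_q^1:H^1(0,T;X)\to P_q(I_\tau;X)\cap H^1(0,T;X)$ is defined by $\partial_t\Pi_q^1w=\Pi_{q-1}^0\partial_tw$ and $(\Pi_q^1w)(t^{n-1})=w(t^{n-1})$, $1\le n\le N$. *)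

(* Defs.v *)
From HB Require Import structures.
From mathcomp Require Import all_boot all_order all_algebra.
From mathcomp Require Import all_classical all_reals all_analysis.
From mathcomp Require Import ring lra.

Set Implicit Arguments.
Unset Strict Implicit.
Unset Printing Implicit Defensive.

Import Order.TTheory GRing.Theory Num.Theory.
Import numFieldNormedType.Exports.

Local Open Scope classical_set_scope.
Local Open Scope ring_scope.

HB.mixin Record CompleteNormedModule_isHilbert (R : realType) V
    & CompleteNormedModule R V := {
  hdot : V -> V -> R;
  hdotC : forall x y, hdot x y = hdot y x;
  hdot_linear : forall z, scalar (hdot ^~ z);
  hdot_norm : forall x, hdot x x = `|x| ^+ 2
}.

#[short(type="hilbertType")]
HB.structure Definition Hilbert (R : realType) :=
  {V of CompleteNormedModule R V & CompleteNormedModule_isHilbert R V}.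

Section hilbert_theory.
Context {R : realType} {V : hilbertType R}.
Implicit Types (x y z : V) (c : R).

Lemma hdotDl x y z : hdot (x + y) z = hdot x z + hdot y z.
Proof. by have := hdot_linear z 1 x y; rewrite scale1r mul1r. Qed.

Lemma hdot0l z : hdot 0 z = 0.
Proof. by have := hdotDl 0 0 z; rewrite addr0; lra. Qed.

Lemma hdotZl c x z : hdot (c *: x) z = c * hdot x z.
Proof. by have := hdot_linear z c x 0; rewrite addr0 hdot0l addr0. Qed.

Lemma hdotDr x y z : hdot x (y + z) = hdot x y + hdot x z.
Proof. by rewrite !(hdotC x) hdotDl. Qed.

Lemma hdotZr c x z : hdot x (c *: z) = c * hdot x z.
Proof. by rewrite !(hdotC x) hdotZl. Qed.

Lemma hdotNl x z : hdot (- x) z = - hdot x z.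
Proof. by rewrite -scaleN1r hdotZl mulN1r. Qed.

Lemma hdotNr x z : hdot x (- z) = - hdot x z.
Proof. by rewrite !(hdotC x) hdotNl. Qed.

Lemma normD_sqr x y : `|x + y| ^+ 2 = `|x| ^+ 2 + 2 * hdot x y + `|y| ^+ 2.
Proof.
by rewrite -!hdot_norm hdotDl !hdotDr (hdotC y x); ring.
Qed.

Lemma normB_sqr x y : `|x - y| ^+ 2 = `|x| ^+ 2 - 2 * hdot x y + `|y| ^+ 2.
Proof. by rewrite normD_sqr normrN hdotNr mulrN. Qed.

Lemma cauchy_schwarz x y : `|hdot x y| <= `|x| * `|y|.
Proof.
have [->|y0] := eqVneq y 0.
  by rewrite hdotC hdot0l !normr0 mulr0.
have yp : 0 < `|y| by rewrite normr_gt0.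
rewrite -(@ler_pXn2r _ 2) ?nnegrE ?mulr_ge0// real_normK ?num_real// exprMn.
have : 0 <= `|x - (hdot x y / `|y| ^+ 2) *: y| ^+ 2 by rewrite sqr_ge0.
rewrite normB_sqr hdotZr normrZ exprMn real_normK ?num_real//.
move=> H; have Y : 0 < `|y| ^+ 2 by rewrite exprn_gt0.
rewrite -subr_ge0.
have -> : `|x| ^+ 2 * `|y| ^+ 2 - hdot x y ^+ 2 =
  (`|x| ^+ 2 - 2 * (hdot x y / `|y| ^+ 2 * hdot x y)
   + (hdot x y / `|y| ^+ 2) ^+ 2 * `|y| ^+ 2) * `|y| ^+ 2.
  by field; rewrite gt_eqF.
by rewrite mulr_ge0// ltW.
Qed.

Lemma hdot_inj x y : (forall z, hdot x z = hdot y z) -> x = y.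
Proof.
move=> H; apply/eqP; rewrite -subr_eq0 -normr_eq0 -sqrf_eq0 -hdot_norm.
by rewrite hdotDl hdotNl H subrr.
Qed.

End hilbert_theory.

Section dual.
Context {R : realType}.

(* The topological dual V^*; the duality product <F, v> is the application F v. *)
Record dual (V : hilbertType R) := Dual {
  dual_fun :> V -> R;
  dual_scalar : scalar dual_fun;
  dual_bounded : exists M, forall v, `|dual_fun v| <= M * `|v| }.

Variable V : hilbertType R.
Implicit Types (F G H : dual V) (c : R).

Lemma dual_ext F G : (forall v, F v = G v) -> F = G.
Proof.
case: F G => [f fl fb] [g gl gb] /= fg.
have e : f = g by apply/funext.
by subst g; congr Dual; apply: Prop_irrelevance.
Qed.

Lemma dualD F v w : F (v + w) = F v + F w.
Proof. by have := dual_scalar F 1 v w; rewrite scale1r mul1r. Qed.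

Lemma dual0 F : F 0 = 0.
Proof. by have := dualD F 0 0; rewrite addr0; lra. Qed.

Lemma dualZ F c v : F (c *: v) = c * F v.
Proof. by have := dual_scalar F c v 0; rewrite !(addr0, dual0). Qed.

Lemma dualN F v : F (- v) = - F v.
Proof. by rewrite -scaleN1r dualZ mulN1r. Qed.

Lemma riesz_exists F : exists u : V, forall v, F v = hdot u v.
Proof.
have [M FM] := dual_bounded F.
pose J v := 2^-1 * `|v| ^+ 2 - F v.
pose E := range J.
have JM v : - (2^-1 * M ^+ 2) <= J v.
  have := FM v; rewrite ler_norml => /andP[_ Fv].
  have := sqr_ge0 (`|v| - M); rewrite /J; nra.
have E0 : E !=set0 by exists (J 0), 0.
have Elb : has_lbound E by exists (- (2^-1 * M ^+ 2)) => _ [v _ <-].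
have dJ v : inf E <= J v by apply: (ge_inf Elb); exists v.
have /boolp.choice[u_ Ju] : forall n : nat, exists v, J v < inf E + n.+1%:R^-1.
  move=> n.
  have [|_ [v _ <-] ?] := @inf_adherent _ E n.+1%:R^-1 _ (conj E0 Elb).
    by rewrite invr_gt0.
  by exists v.
have para v w : `|v - w| ^+ 2 <= 4 * (J v - inf E) + 4 * (J w - inf E).
  have := dJ (2^-1 *: (v + w)); rewrite {1}/J dualZ dualD normrZ exprMn.
  rewrite normD_sqr normB_sqr ger0_norm ?invr_ge0// /J.
  by set i := inf E => ?; lra.
have /cvg_ex[u cu] : cvg (u_ @ \oo).
  apply/cauchy_cvgP/cauchy_exP => e e0.
  have [N HN] : exists N : nat, 8 * N.+1%:R^-1 < e ^+ 2.
    have p : 0 < e ^+ 2 / 8 by rewrite divr_gt0 ?exprn_gt0.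
    have [N _ HN] := near_infty_natSinv_lt (PosNum p).
    by exists N; have /= := HN N (leqnn N); set h := N.+1%:R^-1 => ?; lra.
  exists (u_ N), N => // n /= Nn.
  rewrite -ball_normE /ball_/=.
  rewrite -(@ltr_pXn2r _ 2) ?nnegrE ?(ltW e0)//.
  apply: (le_lt_trans (para _ _)).
  have nN : n.+1%:R^-1 <= N.+1%:R^-1 :> R by rewrite lef_pV2 ?posrE// ler_nat.
  move: HN nN (Ju N) (Ju n); set i := inf E; set h := N.+1%:R^-1.
  by set h' := n.+1%:R^-1 => *; lra.
have Fc : F \o u_ @ \oo --> F u.
  apply/cvgrPdist_le => e e0; near=> n.
  have -> : F u - (F \o u_) n = F (u - u_ n) by rewrite dualD dualN.
  apply: (le_trans (FM _)); apply: (@le_trans _ _ ((`|M| + 1) * `|u - u_ n|)).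
    by rewrite ler_wpM2r// (le_trans (ler_norm M))// lerDl.
  have Mp : 0 < `|M| + 1 by rewrite ltr_wpDl.
  rewrite -ler_pdivlMl//; near: n.
  by move/cvgrPdist_le : cu; apply; rewrite mulr_gt0 ?invr_gt0.
have Jc : J \o u_ @ \oo --> J u.
  have nc : `|u_ n| @[n --> \oo] --> `|u| by exact: cvg_norm.
  apply: cvgB Fc; apply: cvgM; first exact: cvg_cst.
  under eq_fun do rewrite expr2.
  by rewrite expr2; exact: cvgM.
have JuE : J u <= inf E.
  apply: (ler_cvg_to Jc (_ : (fun n => inf E + n.+1%:R^-1) @ \oo --> inf E)).
    rewrite -[X in _ --> X]addr0; apply: cvgD; first exact: cvg_cst.
    exact: cvg_harmonic.
  by near=> n; exact/ltW/Ju.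
have key v (t : R) : 0 <= t * (hdot u v - F v) + 2^-1 * t ^+ 2 * `|v| ^+ 2.
  have := le_trans JuE (dJ (u + t *: v)).
  rewrite /J dualD dualZ normD_sqr hdotZr normrZ exprMn real_normK ?num_real//.
  lra.
exists u => v; apply/eqP; rewrite eq_sym -subr_eq0.
set d := hdot u v - F v.
have [v0|v0] := eqVneq v 0.
  by rewrite /d v0 hdotC hdot0l dual0 subrr.
have := key v (- (d / `|v| ^+ 2)); rewrite -/d.
have : 0 < `|v| ^+ 2 by rewrite exprn_gt0// normr_gt0.
move: (`|v| ^+ 2) => y y0.
have -> : - (d / y) * d + 2^-1 * (- (d / y)) ^+ 2 * y = - (2^-1 * d ^+ 2 / y).
  by field; rewrite gt_eqF.
rewrite oppr_ge0 pmulr_lle0 ?invr_gt0// pmulr_rle0 ?invr_gt0// => d0.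
by rewrite -sqrf_eq0 eq_le d0 sqr_ge0.
Unshelve. all: by end_near. Qed.

Definition riesz F : V := xget 0 [set u | forall v, F v = hdot u v].

Lemma rieszE F v : F v = hdot (riesz F) v.
Proof.
have := xgetPex 0 (riesz_exists F).
by rewrite -/(riesz F) /=.
Qed.

Lemma riesz_unique F u : (forall v, F v = hdot u v) -> riesz F = u.
Proof. by move=> H; apply: hdot_inj => z; rewrite -rieszE H. Qed.

Lemma hdot_dual_scalar (u : V) : scalar (hdot u).
Proof. by move=> c x y; rewrite hdotDr hdotZr. Qed.

Lemma hdot_dual_bounded (u : V) : exists M, forall v, `|hdot u v| <= M * `|v|.
Proof. by exists `|u| => v; exact: cauchy_schwarz. Qed.

Definition hdot_dual u : dual V := Dual (hdot_dual_scalar u) (hdot_dual_bounded u).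

Lemma hdot_dualK : cancel hdot_dual riesz.
Proof. by move=> u; exact: riesz_unique. Qed.

Lemma rieszK : cancel riesz hdot_dual.
Proof. by move=> F; apply: dual_ext => v /=; rewrite -rieszE. Qed.

HB.instance Definition _ := gen_eqMixin (dual V).
HB.instance Definition _ := gen_choiceMixin (dual V).

Lemma dual_add_scalar F G : scalar (fun v => F v + G v).
Proof. by move=> c x y; rewrite !dualD !dualZ; ring. Qed.

Lemma dual_add_bounded F G : exists M, forall v, `|F v + G v| <= M * `|v|.
Proof.
have [M HM] := dual_bounded F; have [N HN] := dual_bounded G.
by exists (M + N) => v; rewrite mulrDl (le_trans (ler_normD _ _))// lerD.
Qed.

Lemma dual_scale_scalar c F : scalar (fun v => c * F v).
Proof. by move=> d x y; rewrite !dualD !dualZ; ring. Qed.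

Lemma dual_scale_bounded c F : exists M, forall v, `|c * F v| <= M * `|v|.
Proof.
have [M HM] := dual_bounded F; exists (`|c| * M) => v.
by rewrite normrM -mulrA ler_wpM2l.
Qed.

Definition dual_add F G := Dual (dual_add_scalar F G) (dual_add_bounded F G).
Definition dual_scale c F := Dual (dual_scale_scalar c F) (dual_scale_bounded c F).
Definition dual_zero := hdot_dual 0.
Definition dual_opp F := dual_scale (- 1) F.

Lemma dual_addA : associative dual_add.
Proof. by move=> F G H; apply: dual_ext => v /=; rewrite addrA. Qed.
Lemma dual_addC : commutative dual_add.
Proof. by move=> F G; apply: dual_ext => v /=; rewrite addrC. Qed.
Lemma dual_add0 : left_id dual_zero dual_add.
Proof. by move=> F; apply: dual_ext => v /=; rewrite hdot0l add0r. Qed.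
Lemma dual_addN : left_inverse dual_zero dual_opp dual_add.
Proof. by move=> F; apply: dual_ext => v /=; rewrite hdot0l mulN1r addNr. Qed.

HB.instance Definition _ :=
  GRing.isZmodule.Build (dual V) dual_addA dual_addC dual_add0 dual_addN.

Lemma dual_scaleA c d F : dual_scale c (dual_scale d F) = dual_scale (c * d) F.
Proof. by apply: dual_ext => v /=; rewrite mulrA. Qed.
Lemma dual_scale1 : left_id 1 dual_scale.
Proof. by move=> F; apply: dual_ext => v /=; rewrite mul1r. Qed.
Lemma dual_scaleDr : right_distributive dual_scale +%R.
Proof. by move=> c F G; apply: dual_ext => v /=; rewrite mulrDr. Qed.
Lemma dual_scaleDl F : {morph dual_scale^~ F : c d / c + d}.
Proof. by move=> c d; apply: dual_ext => v /=; rewrite mulrDl. Qed.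

HB.instance Definition _ := GRing.Zmodule_isLmodule.Build R (dual V)
  dual_scaleA dual_scale1 dual_scaleDr dual_scaleDl.

Definition dual_norm F : R := sup [set `|F v| | v in [set v : V | `|v| <= 1]].

Lemma dual_normE F : dual_norm F = `|riesz F|.
Proof.
set u := riesz F.
have ub : ubound [set `|F v| | v in [set v : V | `|v| <= 1]] `|u|.
  move=> _ [v /= v1 <-]; rewrite rieszE (le_trans (cauchy_schwarz _ _))//.
  by rewrite ler_piMr.
apply/eqP; rewrite eq_le; apply/andP; split.
  apply: ge_sup => //; exists `|F 0|, 0 => //=.
  by rewrite normr0.
apply: ub_le_sup; first by exists `|u|.
have [u0|u0] := eqVneq u 0.
  by exists 0 => /=; rewrite ?u0 ?normr0// dual0 normr0.
have up : 0 < `|u| by rewrite normr_gt0.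
exists (`|u|^-1 *: u) => /=.
  by rewrite normrZ normfV normr_id mulVf// gt_eqF.
rewrite rieszE -/u hdotZr hdot_norm normrM normfV normr_id.
by rewrite (ger0_norm (sqr_ge0 _)) expr2 mulrA mulVf ?mul1r// gt_eqF.
Qed.

Lemma rieszD F G : riesz (F + G) = riesz F + riesz G.
Proof. by apply: riesz_unique => v; rewrite hdotDl -!rieszE. Qed.

Lemma rieszZ c F : riesz (c *: F) = c *: riesz F.
Proof. by apply: riesz_unique => v; rewrite hdotZl -!rieszE. Qed.

Lemma dual_normD F G : dual_norm (F + G) <= dual_norm F + dual_norm G.
Proof. by rewrite !dual_normE rieszD ler_normD. Qed.

Lemma dual_normZ c F : dual_norm (c *: F) = `|c| * dual_norm F.
Proof. by rewrite !dual_normE rieszZ normrZ. Qed.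

Lemma dual_norm_eq0 F : dual_norm F = 0 -> F = 0.
Proof.
rewrite dual_normE => /normr0_eq0 rF; apply: dual_ext => v.
by rewrite rieszE rF.
Qed.

HB.instance Definition _ := Lmodule_isNormed.Build R (dual V)
  dual_normD dual_normZ dual_norm_eq0.

Lemma riesz_isom F : `|riesz F| = `|F|.
Proof. by rewrite -dual_normE. Qed.

Lemma rieszB F G : riesz (F - G) = riesz F - riesz G.
Proof. by rewrite rieszD -scaleN1r rieszZ scaleN1r. Qed.

Lemma dual_complete (A : set_system (dual V)) : ProperFilter A -> cauchy A -> cvg A.
Proof.
move=> FA /cauchyP cA.
have /cvg_ex[/= u cu] : cvg (riesz @ A).
  apply/cauchy_cvgP/cauchyP => e e0; have [F AF] := cA e e0.
  exists (riesz F); move: AF; rewrite /fmap/=; apply: filterS => G /=.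
  by rewrite -!ball_normE /ball_/= -rieszB riesz_isom.
apply/cvg_ex; exists (hdot_dual u); apply/cvgrPdist_lt => e e0.
have /cvgrPdist_lt/(_ e e0) := cu; apply: filterS => F.
by rewrite -{1}(hdot_dualK u) -rieszB riesz_isom.
Qed.

HB.instance Definition _ := Uniform_isComplete.Build (dual V) dual_complete.

(* The inner product of V^*, transported by the Riesz isomorphism. *)
Definition dual_dot F G : R := hdot (riesz F) (riesz G).

Lemma dual_dotC F G : dual_dot F G = dual_dot G F.
Proof. exact: hdotC. Qed.
Lemma dual_dot_linear G : scalar (dual_dot ^~ G).
Proof. by move=> c F H; rewrite /dual_dot rieszD rieszZ hdotDl hdotZl. Qed.
Lemma dual_dot_norm F : dual_dot F F = `|F| ^+ 2.
Proof. by rewrite /dual_dot hdot_norm riesz_isom. Qed.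

HB.instance Definition _ := CompleteNormedModule_isHilbert.Build R (dual V)
  dual_dotC dual_dot_linear dual_dot_norm.

End dual.

Section bochner.
Context {R : realType} {X : hilbertType R}.
Implicit Types (D : set R) (T : R) (w : R -> X) (phi : R -> R).

Definition simple_on D w : Prop :=
  finite_set (w @` D) /\ forall x, measurable (D `&` w @^-1` [set x]).

Definition strongly_measurable_on D w : Prop :=
  exists s : nat -> R -> X, (forall n, simple_on D (s n)) /\
    (forall t, D t -> s n t @[n --> \oo] --> w t).

(* Elements of L^2(0,T;X) are given by a strongly measurable representative;
   its values outside ]0, T[ are irrelevant. *)
Definition L2 T w : Prop :=
  strongly_measurable_on `]0, T[ w /\
  (\int[lebesgue_measure]_(t in `]0%R, T[) (`|w t| ^+ 2)%:E < +oo)%E.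

(* Test functions in C^1_c(]0, T[). *)
Definition test_function T phi : Prop :=
  [/\ forall t, derivable phi t 1, continuous (derive1 phi) &
      exists a b, [/\ 0 < a, b < T & forall t, t \notin `[a, b] -> phi t = 0]].

(* The identity of X-valued integrals
     \int_0^T w phi' dt = - \int_0^T w' phi dt
   is tested against the elements of X. *)
Definition weak_derivative T w w' : Prop :=
  L2 T w' /\ forall phi, test_function T phi -> forall x : X,
    \int[lebesgue_measure]_(t in `]0, T[) (hdot (w t) x * derive1 phi t) =
    - \int[lebesgue_measure]_(t in `]0, T[) (hdot (w' t) x * phi t).

(* Elements of H^1(0,T;X) are given by their continuous representative. *)
Definition H1 T w : Prop :=
  [/\ {within `[0, T], continuous w}, L2 T w &
      exists w', weak_derivative T w w'].

Definition weak_deriv T w : R -> X :=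
  xget (fun=> 0) [set w' | weak_derivative T w w'].

End bochner.

Definition time_grid {R : realType} (tau : nat -> R) (N : nat) (T : R) : Prop :=
  [/\ tau 0%N = 0, tau N = T & forall n, (n < N)%N -> tau n < tau n.+1].

Section piecewise_polynomials.
Context {R : realType} {X : hilbertType R}.
Implicit Types (tau : nat -> R) (N m q : nat) (S : set X) (w W : R -> X).

(* P_m(I_tau;S), for a subspace S of X: the values at the nodes, where a
   function may jump, are left unconstrained. *)
Definition pwpoly tau N S m w : Prop :=
  forall n, (n < N)%N -> exists c : 'I_m.+1 -> X, (forall i, S (c i)) /\
    forall t, t \in `]tau n, tau n.+1[ -> w t = \sum_(i < m.+1) t ^+ i *: c i.

(* The L^2(0, tau N; X)-orthogonal projection onto P_m(I_tau;X), determined up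
   to its values at the nodes and outside ]0, tau N[. *)
Definition Pi0 tau N m w : R -> X :=
  xget (fun=> 0) [set W | pwpoly tau N setT m W /\
    forall phi, pwpoly tau N setT m phi ->
      \int[lebesgue_measure]_(t in `]0, tau N[) hdot (w t - W t) (phi t) = 0].

(* Determined on [0, tau N], by continuity. *)
Definition Pi1 tau N q w : R -> X :=
  xget (fun=> 0) [set W | [/\ pwpoly tau N setT q W, H1 (tau N) W,
    weak_derivative (tau N) W (Pi0 tau N q.-1 (weak_deriv (tau N) w)) &
    forall n, (n < N)%N -> W (tau n) = w (tau n)]].

End piecewise_polynomials.

Section forms.
Context {R : realType}.

Definition form_bounded (X : hilbertType R) (a : X -> X -> R) : Prop :=
  exists C, forall x y, `|a x y| <= C * `|x| * `|y|.

Definition form_elliptic (X : hilbertType R) (a : X -> X -> R) : Prop :=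
  exists c, 0 < c /\ forall x, c * `|x| ^+ 2 <= a x x.

Definition form_symmetric (X : hilbertType R) (a : X -> X -> R) : Prop :=
  forall x y, a x y = a y x.

Definition energy_norm (X : hilbertType R) (a : X -> X -> R) (x : X) : R :=
  Num.sqrt (a x x).

Definition compact_embedding (X Y : hilbertType R) (emb : X -> Y) : Prop :=
  injective emb /\ compact (closure (emb @` [set x | `|x| <= 1])).

Definition fin_dim_subspace (X : hilbertType R) (S : set X) : Prop :=
  exists (n : nat) (e : 'I_n -> X),
    S = [set x | exists c : 'I_n -> R, x = \sum_i c i *: e i].

End forms.

Section scheme.
Context {R : realType} {V Q Q0 : hilbertType R}.

(* The first equation is imposed at every t in ]0, tau N], the second one in the
   interior of each time interval: dU/dt and the projections of degree q - 1 are
   two-valued at the interior nodes. *)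
Definition discrete_solution (a : V -> V -> R) (k : Q -> Q -> R)
    (b : V -> Q0 -> R) (emb : Q -> Q0) (Vh : set V) (Qh : set Q)
    (tau : nat -> R) (N q : nat) (f : R -> dual V) (g : R -> dual Q)
    (uh0 : V) (ph0 : Q) (U : R -> V) (P : R -> Q) : Prop :=
  [/\ pwpoly tau N Vh q U /\ H1 (tau N) U,
      pwpoly tau N Qh q P /\ H1 (tau N) P,
      U 0 = uh0 /\ P 0 = ph0,
      forall t, 0 < t <= tau N -> forall vh, Vh vh ->
        a (U t) vh - b vh (emb (P t)) = Pi1 tau N q f t vh &
      forall n, (n < N)%N -> forall t, t \in `]tau n, tau n.+1[ ->
        forall qh, Qh qh ->
        b (derive1 U t) (emb qh) + k (Pi0 tau N q.-1 P t) qh =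
        Pi0 tau N q.-1 g t qh].

End scheme.

(* Main.v *)
Require Import Defs.
From HB Require Import structures.
From mathcomp Require Import all_boot all_order all_algebra.
From mathcomp Require Import all_classical all_reals all_analysis.
From mathcomp Require Import measurable_realfun ring lra.

(** The displacement equation determines the displacement: with the solution
    operators [load_disp] and [pressure_disp] of the elliptic form a on Vh, the
    first equation reads U = load_disp (Pi^1 f) + pressure_disp P at every time.
    At t = 0 it is the compatibility of the projected initial values, as
    Pi^1 f (0) = f (0). Inserting this into the second equation leaves, for P
    alone, a Galerkin scheme for the finite dimensional equation
    c(P', z) + k(P, z) = load, where the Schur complement
    c(p, z) = b(pressure_disp p, emb z) is positive semidefinite and, by the
    inf-sup condition on the discrete spaces, definite on Qh.

    On one time interval both sides of the second equation are polynomials of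
    degree q - 1 in t, so it holds pointwise iff it holds against the monomials
    t^j with j < q. Against these, the projection of P may be replaced by P
    itself ([pressure_equation_weak]). With P given at the left node, this is a
    square linear system. It is injective: a solution of the homogeneous problem
    that vanishes at the left node, tested with P', has a vanishing integral of
    c(P', P') plus half of k(P, P) at the right node, hence P' = 0
    ([step_form_eq0]). So it is uniquely solvable ([step_form_exists]); marching
    through the grid gives existence and uniqueness ([solution_exists],
    [solution_unique]).

    For the energy identity, the first equation is tested with U' and the second
    one with P; the coupling terms cancel, a(U, U') integrates to increments of
    a(U, U) / 2, and the integrals of k(Pi^0 P, P) and k(Pi^0 P, Pi^0 P) agree
    ([energy_step], [energy_identity]).

    What remains is that the projections exist. The moments of an L^2 function
    against t^j are bounded linear forms in the direction, hence vectors by the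
    Riesz theorem, and the Gram matrix of the monomials turns them into the
    coefficients of Pi^0 ([Pi0_set_nonempty]). For Pi^1, the primitive of the
    projected weak derivative started at f(0) must take the values of f at all
    nodes. This is the fundamental theorem of calculus for the continuous
    representative of an H^1 function ([weak_derivative_increment]), obtained by
    testing the weak derivative with C^1 trapezoids that converge to the
    indicator of a time interval ([Pi1_set_nonempty]). *)

Set Implicit Arguments.
Unset Strict Implicit.
Unset Printing Implicit Defensive.

Import Order.TTheory GRing.Theory Num.Theory.
Import numFieldNormedType.Exports.

Local Open Scope classical_set_scope.
Local Open Scope ring_scope.

(** * Integrals of real polynomials *)

Section poly_integral.
Context {R : realType}.
Implicit Types (p r : {poly R}) (x y : R).

Definition antideriv p : {poly R} := \poly_(i < (size p).+1) (p`_i.-1 / i%:R).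

Lemma coef_antideriv p i : (antideriv p)`_i = p`_i.-1 / i%:R.
Proof.
rewrite coef_poly; case: ltnP => //; case: i => // i si.
by rewrite nth_default ?mul0r.
Qed.

Lemma antideriv_linear : linear antideriv.
Proof.
move=> c p r; apply/polyP => i.
by rewrite coefD coefZ !coef_antideriv coefD coefZ; ring.
Qed.

HB.instance Definition _ := GRing.isLinear.Build R {poly R} {poly R} _ antideriv
  antideriv_linear.

Lemma deriv_antideriv p : (antideriv p)^`() = p.
Proof.
apply/polyP => i; rewrite coef_deriv coef_antideriv /= -(mulr_natr (_ / _)).
by rewrite divfK// pnatr_eq0.
Qed.

Lemma deriv_eq0 p : p^`() = 0 -> p = (p`_0)%:P.
Proof.
move=> /polyP p0; apply/polyP => -[|i]; rewrite coefC//=.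
by have /eqP := p0 i; rewrite coef_deriv coef0 mulrn_eq0 => /eqP.
Qed.

(** The integral of a polynomial over [x, y], defined formally: it is a linear
    form on the algebra of polynomials, so that integrals of sums and products
    are computed by algebra. *)
Definition pint x y p : R := (antideriv p).[y] - (antideriv p).[x].

Lemma pint_scalar x y : scalar (pint x y).
Proof. by move=> c p r; rewrite /pint linearP !hornerE /=; ring. Qed.

HB.instance Definition _ x y := GRing.isLinear.Build R {poly R} R _ (pint x y)
  (pint_scalar x y).

Lemma pint_deriv x y p : pint x y p^`() = p.[y] - p.[x].
Proof.
have /deriv_eq0 e : (antideriv p^`() - p)^`() = 0.
  by rewrite linearB /= deriv_antideriv subrr.
rewrite /pint -[antideriv _](subrK p) e !hornerE; ring.
Qed.

Lemma poly_eq0_itv x y p : x < y -> (forall t, t \in `]x, y[ -> p.[t] = 0) ->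
  p = 0.
Proof.
move=> xy p0; apply/eqP; apply: contraT => pn0.
(* [size p] equidistant points of ]x, y[, one root too many. *)
pose s := [seq x + (y - x) * i.+1%:R / (size p).+1%:R | i <- iota 0 (size p)].
have := @max_poly_roots _ p s pn0 _ _; rewrite size_map size_iota ltnn => ->//.
- apply/allP => _ /mapP[i + ->]; rewrite mem_iota /= add0n => ip.
  apply/eqP/p0; rewrite in_itv/= -mulrA ltrDl mulr_gt0 ?subr_gt0 ?divr_gt0//=.
  rewrite -ltrBrDl gtr_pMr ?subr_gt0// ltr_pdivrMr// mul1r ltr_nat.
  by rewrite ltnS.
- rewrite map_inj_uniq ?iota_uniq// => i j /addrI.
  have sp : (size p).+1%:R != 0 :> R by rewrite pnatr_eq0.
  move/(mulIf (invr_neq0 sp))/(mulfI _); rewrite subr_eq0 gt_eqF// => /(_ isT).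
  by move/eqP; rewrite eqr_nat eqSS => /eqP.
Qed.

Lemma poly_eq_itv x y p r : x < y ->
  (forall t, t \in `]x, y[ -> p.[t] = r.[t]) -> p = r.
Proof.
move=> xy pr; apply/eqP; rewrite -subr_eq0; apply/eqP.
by apply: (poly_eq0_itv xy) => t /pr; rewrite !hornerE => ->; rewrite subrr.
Qed.

Lemma antideriv_nondecreasing x y p : (forall t, t \in `]x, y[ -> 0 <= p.[t]) ->
  forall s t, x <= s -> s <= t -> t <= y -> (antideriv p).[s] <= (antideriv p).[t].
Proof.
move=> p0; apply: ger0_derive1_ndecr.
- by move=> t _; exact: derivable_horner.
- by move=> t /p0; rewrite -derivE deriv_antideriv.
- by apply: continuous_subspaceT; exact: continuous_horner.
Qed.

Lemma pint_ge0 x y p : x <= y -> (forall t, t \in `]x, y[ -> 0 <= p.[t]) ->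
  0 <= pint x y p.
Proof.
by move=> xy p0; rewrite subr_ge0 (antideriv_nondecreasing p0).
Qed.

(** A primitive of a nonnegative polynomial is nondecreasing; if its increment
    over [x, y] vanishes it is constant there, hence constant. *)
Lemma pint_eq0 x y p : x < y -> (forall t, t \in `]x, y[ -> 0 <= p.[t]) ->
  pint x y p = 0 -> p = 0.
Proof.
move=> xy p0 /eqP; rewrite subr_eq0 => /eqP Fyx.
suff /(congr1 (@deriv _)) : antideriv p = ((antideriv p).[x])%:P.
  by rewrite deriv_antideriv derivC.
apply: (poly_eq_itv xy) => t; rewrite in_itv/= hornerC => /andP[xt ty].
apply/eqP; rewrite eq_le -{1}Fyx.
by rewrite !(antideriv_nondecreasing p0)// ltW.
Qed.

(** Such a p is orthogonal to itself. *)
Lemma pint_orth x y n p : x < y -> (size p <= n)%N ->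
  (forall j : 'I_n, pint x y (p * 'X^j) = 0) -> p = 0.
Proof.
move=> xy sp p0; apply/eqP; rewrite -sqrf_eq0 expr2; apply/eqP.
apply: (pint_eq0 xy) => [t _|]; first by rewrite hornerM -expr2 sqr_ge0.
have {2}-> : p = \sum_(j < n) p`_j *: 'X^j.
  rewrite -{1}[p]coefK poly_def (big_ord_widen n (fun i => p`_i *: 'X^i))//.
  rewrite big_mkcond; apply: eq_bigr => i _; case: ltnP => // pi.
  by rewrite nth_default ?scale0r.
rewrite mulr_sumr linear_sum big1// => j _.
by rewrite -scalerAr linearZ /= p0 mulr0.
Qed.

Notation mu := (@lebesgue_measure R).

Lemma within_continuous_integrable x y (h : R -> R) :
  {within `[x, y], continuous h} -> mu.-integrable `]x, y[ (EFin \o h).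
Proof.
move=> ch; apply: (@integrableS _ _ _ mu `[x, y]%classic) => //.
  exact: subset_itv_oo_cc.
by apply: continuous_compact_integrable => //; exact: segment_compact.
Qed.

Lemma integrable_horner x y p : mu.-integrable `]x, y[ (fun t => (p.[t])%:E).
Proof.
apply: within_continuous_integrable.
by apply: continuous_subspaceT; exact: continuous_horner.
Qed.

Lemma Rintegral_itvoo_itvcc x y (h : R -> R) :
  mu.-integrable `]x, y[ (EFin \o h) ->
  \int[mu]_(t in `[x, y]) h t = \int[mu]_(t in `]x, y[) h t.
Proof.
move=> ih; rewrite /Rintegral; congr fine.
rewrite (@integral_itv_bndoo _ x y (EFin \o h) true false)//.
exact: (measurable_int mu).
Qed.

Lemma Rintegral_horner x y p : x < y ->
  \int[mu]_(t in `]x, y[) p.[t] = pint x y p.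
Proof.
move=> xy; rewrite -Rintegral_itvoo_itvcc; last exact: integrable_horner.
rewrite /Rintegral (continuous_FTC2 (F := horner (antideriv p)))//.
- by apply: continuous_subspaceT; exact: continuous_horner.
- split=> [t _||]; first exact: derivable_horner.
  + exact/cvg_at_right_filter/continuous_horner.
  + exact/cvg_at_left_filter/continuous_horner.
- by move=> t _; rewrite -derivE deriv_antideriv.
Qed.

End poly_integral.

(** * Time grids *)

Section grid.
Context {R : realType}.
Variables (tau : nat -> R) (N : nat).
Hypothesis tauS : forall n, (n < N)%N -> tau n < tau n.+1.

Lemma grid_le i j : (i <= j)%N -> (j <= N)%N -> tau i <= tau j.
Proof.
elim: j => [|j IH]; first by rewrite leqn0 => /eqP->.
rewrite leq_eqVlt => /predU1P[->//|ij] jN.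
by apply: (le_trans (IH ij (ltnW jN))); rewrite ltW// tauS.
Qed.

Lemma grid_lt i j : (i < j)%N -> (j <= N)%N -> tau i < tau j.
Proof.
move=> ij jN; apply: (@lt_le_trans _ _ (tau i.+1)).
  by apply: tauS; exact: leq_trans jN.
exact: grid_le.
Qed.

Lemma grid_itv_sub i n : (i < n)%N -> (n <= N)%N ->
  `]tau i, tau i.+1[ `<=` `]tau 0%N, tau n[.
Proof.
move=> iN nN; apply: subset_itv; rewrite bnd_simp.
  by rewrite grid_le// (leq_trans (ltnW iN)).
by rewrite grid_le.
Qed.

Lemma grid_itv_setU n : (n < N)%N ->
  `]tau 0%N, tau n.+1[%classic =
    if n is 0%N then `]tau n, tau n.+1[%classic
    else `]tau 0%N, tau n[ `|` ([set tau n] `|` `]tau n, tau n.+1[).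
Proof.
case: n => // n nN.
rewrite (@itv_bndbnd_setU _ _ _ (BLeft (tau n.+1))) ?bnd_simp; last 2 first.
- by rewrite grid_lt// ltnW.
- by rewrite grid_le.
by rewrite setU1itv// bnd_simp grid_lt.
Qed.

(** The nodes are added one by one as singletons, since functions given on the
    open time intervals are arbitrary there. *)
Lemma grid_ind (K : set R -> Prop) :
  K set0 -> (forall x, K [set x]) ->
  (forall i, (i < N)%N -> K `]tau i, tau i.+1[%classic) ->
  (forall A B, measurable A -> measurable B -> [disjoint A & B] ->
     K A -> K B -> K (A `|` B)) ->
  forall n, (n <= N)%N -> K `]tau 0%N, tau n[%classic.
Proof.
move=> K0 K1 Kp KU; elim=> [|n IH] nN; first by rewrite set_itvoo0.
rewrite grid_itv_setU//; case: n IH nN => [_ |n IH nN]; first exact: Kp.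
apply: (KU) => //; first exact: measurableU.
- apply/disj_setPS => x /= []; rewrite in_itv/= => /andP[_ xn] [xE|].
    by rewrite xE ltxx in xn.
  by rewrite in_itv/= => /andP[nx _]; have := lt_trans xn nx; rewrite ltxx.
- exact/IH/ltnW.
- apply: (KU) => //; last exact: Kp.
  by apply/disj_setPS => x /= [-> ]; rewrite in_itv/= ltxx.
Qed.

End grid.

(** * Strongly measurable functions and L^2(0, T; X) *)

Section strong_measurability.
Import HBSimple.
Context {R : realType} {X : hilbertType R}.
Implicit Types (D : set R) (w : R -> X).
Notation mu := (@lebesgue_measure R).

Lemma continuous_hdot (x : X) : continuous (fun y : X => hdot y x).
Proof.
move=> y; apply/cvgrPdist_le => e e0; near=> z.
rewrite -hdotNl -hdotDl (le_trans (cauchy_schwarz _ _))//.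
apply: (@le_trans _ _ (`|y - z| * (`|x| + 1))).
  by rewrite ler_wpM2l// lerDl.
rewrite -ler_pdivlMr ?ltr_wpDl//; near: z.
by apply: cvgr_dist_le; [exact: cvg_id|rewrite divr_gt0 ?ltr_wpDl].
Unshelve. all: by end_near. Qed.

Lemma simple_on_measurable_fun D w (h : X -> R) :
  simple_on D w -> measurable_fun D (h \o w).
Proof.
move=> [fw mw] _ B mB.
rewrite (_ : _ `&` _ = \bigcup_(x in w @` D `&` h @^-1` B) (D `&` w @^-1` [set x])).
  apply: fin_bigcup_measurable => //; exact: finite_setIl.
apply/seteqP; split=> [t [Dt /= Bt]|t [x [_ Bx] [Dt /= wt]]].
  by exists (w t) => //; split => //; exists t.
by split => //=; rewrite wt.
Qed.

Lemma strongly_measurable_fun D w (h : X -> R) : continuous h ->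
  strongly_measurable_on D w -> measurable_fun D (h \o w).
Proof.
move=> ch [s [ss sw]].
apply: (@measurable_realfun.measurable_fun_cvg _ _ _ D (fun n => h \o s n)).
  by move=> n; exact: simple_on_measurable_fun.
by move=> t Dt; apply: continuous_cvg; [exact: ch|exact: sw].
Qed.

(** Composing [w] with simple functions that converge to the identity of the
    real line reduces the claim to scalar functions. *)
Lemma continuous_strongly_measurable D w : measurable D -> continuous w ->
  strongly_measurable_on D w.
Proof.
move=> mD cw; have mid : measurable_fun D (fun t : R => t%:E).
  by apply/measurable_EFinP; exact: measurable_id.
have [g gid] := approximation_sfun mD mid.
exists (fun n => w \o g n); split=> [n|t Dt].
- have fg : finite_set (range (g n)) by exact: fimfunP.
  split=> [|x].
    apply: (@sub_finite_set _ _ (w @` range (g n))); last exact: finite_image.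
    by move=> _ [t Dt <-]; exists (g n t) => //; exists t.
  apply: measurableI => //.
  rewrite (_ : _ @^-1` _ =
      \bigcup_(y in range (g n) `&` w @^-1` [set x]) (g n @^-1` [set y])).
    by apply: fin_bigcup_measurable => //; exact: finite_setIl.
  apply/seteqP; split=> [s /= wx|s [y [_ wy] /= ->//]].
  by exists (g n s) => //; split => //; exists s.
- apply: (cvg_comp (g^~ t) w) (cw t).
  exact: (fine_cvg (gid t Dt)).
Qed.

Lemma strongly_measurable_setU D D' w : measurable D -> measurable D' ->
  [disjoint D & D'] ->
  strongly_measurable_on D w -> strongly_measurable_on D' w ->
  strongly_measurable_on (D `|` D') w.
Proof.
move=> mD mD' /disj_setPS DD' [s [ss sw]] [s' [ss' sw']].
have D'D t : D' t -> (t \in D) = false.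
  by move=> D't; apply/negbTE/negP => /set_mem Dt; exact: (DD' t).
exists (fun n t => if t \in D then s n t else s' n t); split=> [n|t [Dt|D't]].
- split=> [|x].
    apply: (@sub_finite_set _ _ (s n @` D `|` s' n @` D')).
      move=> _ [t Dt <-]; case: ifPn => [/set_mem|tD].
        by move=> ?; left; exists t.
      by right; exists t => //; case: Dt => // /mem_set; rewrite (negbTE tD).
    by rewrite finite_setU; split; [case: (ss n)|case: (ss' n)].
  rewrite (_ : _ `&` _ = D `&` s n @^-1` [set x] `|` D' `&` s' n @^-1` [set x]).
    by apply: measurableU; [case: (ss n)|case: (ss' n)].
  apply/seteqP; split=> [t [/= [Dt|D't]]|t [] [Dt /=]].
  + by rewrite mem_set//; left.
  + by rewrite D'D//; right.
  + by split; [left|rewrite /= mem_set].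
  + by split; [right|rewrite /= D'D].
- by rewrite mem_set//; exact: sw.
- by rewrite D'D//; exact: sw'.
Qed.

Lemma strongly_measurable_ext D w w' : {in D, w =1 w'} ->
  strongly_measurable_on D w -> strongly_measurable_on D w'.
Proof.
move=> ww' [s [ss sw]]; exists s; split => // t Dt.
by rewrite -ww' ?inE//; exact: sw.
Qed.

Lemma strongly_measurable_set1 t w : strongly_measurable_on [set t] w.
Proof.
apply: (@strongly_measurable_ext _ (cst (w t))).
  by move=> s /set_mem ->.
by apply: continuous_strongly_measurable => // s; exact: cvg_cst.
Qed.

Lemma strongly_measurable_set0 w : strongly_measurable_on set0 w.
Proof.
exists (fun=> w); split => // n; split; first by rewrite image_set0.
by move=> x; rewrite set0I.
Qed.

Lemma lebesgue_itvoo_lty x y : (mu `]x, y[ < +oo)%E.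
Proof.
by rewrite lebesgue_measure_itv/=; case: ifP => _; rewrite ?ltry// -EFinB ltry.
Qed.

Lemma bounded_L2 T w M : strongly_measurable_on `]0, T[ w ->
  (forall t, t \in `]0, T[ -> `|w t| <= M) -> L2 T w.
Proof.
move=> sw wM; split => //.
have mw : measurable_fun `]0, T[ (fun t => `|w t| ^+ 2).
  by apply: measurable_funX; apply: strongly_measurable_fun sw; exact: norm_continuous.
have bw : [bounded `|w t| ^+ 2 : R^o | t in `]0, T[%classic].
  exists (M ^+ 2); split; first exact: num_real.
  move=> y My t /wM wt /=; apply: le_trans (ltW My).
  by rewrite ger0_norm ?sqr_ge0// lerXn2r ?nnegrE// (le_trans _ wt).
have : mu.-integrable `]0, T[ (EFin \o (fun t => `|w t| ^+ 2)).
  by apply: measurable_bounded_integrable => //; exact: lebesgue_itvoo_lty.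
case/integrableP => _; apply: le_lt_trans; rewrite le_eqVlt; apply/orP; left.
by apply/eqP/eq_integral => t _ /=; rewrite ger0_norm ?sqr_ge0.
Qed.

Lemma L2_integrable_norm T w : L2 T w ->
  mu.-integrable `]0, T[ (EFin \o (fun t => `|w t|)).
Proof.
move=> [sw w2].
have mw : measurable_fun `]0, T[ (fun t => `|w t|).
  by apply: strongly_measurable_fun sw; exact: norm_continuous.
have i1 : mu.-integrable `]0, T[ (EFin \o cst 1).
  apply: measurable_bounded_integrable => //; first exact: lebesgue_itvoo_lty.
  exact: bounded_cst.
have i2 : mu.-integrable `]0, T[ (EFin \o (fun t => `|w t| ^+ 2)).
  apply/integrableP; split; first by apply/measurable_EFinP/measurable_funX.
  apply: le_lt_trans w2; rewrite le_eqVlt; apply/orP; left; apply/eqP.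
  by apply: eq_integral => t _ /=; rewrite ger0_norm ?sqr_ge0.
apply: le_integrable (integrableD _ i1 i2) => //; first exact/measurable_EFinP.
move=> t _ /=; rewrite lee_fin normr_id ger0_norm ?addr_ge0 ?sqr_ge0//.
by have := sqr_ge0 (`|w t| - 1); rewrite sqrrB1; have := normr_ge0 (w t); lra.
Qed.

Lemma L2_integrable_hdot T w x (h : R -> R) M D : L2 T w ->
  measurable D -> D `<=` `]0, T[ ->
  measurable_fun D h -> (forall t, D t -> `|h t| <= M) ->
  mu.-integrable D (EFin \o (fun t => hdot (w t) x * h t)).
Proof.
move=> w2 mD sD mh hM.
have iw := L2_integrable_norm w2.
have {iw} : mu.-integrable D (EFin \o (fun t => `|w t|)).
  by apply: integrableS iw.
move=> iw; apply: le_integrable (integrableZl _ (`|x| * M) iw) => //.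
  apply/measurable_EFinP; apply: measurable_funM => //.
  apply: (@measurable_funS _ _ _ _ `]0, T[%classic) => //.
  apply: (@strongly_measurable_fun _ w (hdot^~ x)); last by case: w2.
  exact: continuous_hdot.
move=> t Dt /=; rewrite lee_fin normrM.
have := cauchy_schwarz (w t) x; have := hM t Dt => hM' cs.
have M0 : 0 <= M by exact: le_trans hM'.
rewrite [leRHS]ger0_norm ?mulr_ge0//; apply: (le_trans (ler_pM _ _ cs hM')) => //.
by rewrite le_eqVlt; apply/orP; left; apply/eqP; ring.
Qed.

End strong_measurability.

(** * Polynomials with values in a Hilbert space *)

Lemma scalar_sum {R : realType} {X : hilbertType R} (l : X -> R) (I : finType)
    (s : I -> R) (c : I -> X) : scalar l ->
  l (\sum_i s i *: c i) = \sum_i s i * l (c i).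
Proof.
move=> ll; have lD x y : l (x + y) = l x + l y.
  by rewrite -[x in LHS]scale1r ll mul1r.
have l0 : l 0 = 0 by have := lD 0 0; rewrite addr0; lra.
have lZ a x : l (a *: x) = a * l x by rewrite -[_ *: _]addr0 ll l0 addr0.
by rewrite (big_morph l lD l0); apply: eq_bigr => i _.
Qed.

Lemma scalarB {R : realType} {X : hilbertType R} (l : X -> R) x y : scalar l ->
  l (x - y) = l x - l y.
Proof.
by move=> ll; rewrite -[- y]scaleN1r [in LHS]addrC ll; ring.
Qed.

Section bilinear_scalar.
Context {R : realType} {X Y : hilbertType R}.
Variable c : {bilinear X -> Y -> R | *%R & *%R}.

Lemma bilinear_scalarl y : scalar (c^~ y).
Proof. by move=> s u v; rewrite linearPl. Qed.

Lemma bilinear_scalarr x : scalar (c x).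
Proof. by move=> s u v; rewrite linearPr. Qed.

End bilinear_scalar.

Lemma dual_eval_scalar {R : realType} {X : hilbertType R} (v : X) :
  scalar (fun F : dual X => F v).
Proof. by []. Qed.

Section vector_polynomials.
Context {R : realType} {X : hilbertType R}.
Implicit Types (l : X -> R).

(** X-valued polynomials, as in the definition of P_m(I_tau; X); applying a
    linear form to one gives the real polynomial [lpoly]. *)
Definition vpoly n (c : 'I_n -> X) (t : R) : X := \sum_(i < n) t ^+ i *: c i.

Definition lpoly l n (c : 'I_n -> X) : {poly R} := \sum_(i < n) l (c i) *: 'X^i.

Lemma horner_lpoly l n (c : 'I_n -> X) t : scalar l ->
  (lpoly l c).[t] = l (vpoly c t).
Proof.
move=> ll; rewrite horner_sum scalar_sum//; apply: eq_bigr => i _.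
by rewrite hornerZ hornerXn mulrC.
Qed.

Lemma size_lpoly l n (c : 'I_n -> X) : (size (lpoly l c) <= n)%N.
Proof.
apply: (leq_trans (size_sum _ _ _)); apply/bigmax_leqP => i _.
by rewrite (leq_trans (size_scale_leq _ _))// size_polyXn.
Qed.

Lemma continuous_vpoly n (c : 'I_n -> X) : continuous (vpoly c).
Proof.
move=> t; rewrite /continuous_at /vpoly.
rewrite (_ : (fun s => \sum_i _) = \sum_(i < n) (fun s : R => s ^+ i *: c i)); last first.
  by apply/funext => s; rewrite fct_sumE.
rewrite (_ : \sum_(i < n) t ^+ i *: c i =
    (\sum_(i < n) (fun s : R => s ^+ i *: c i)) t); last first.
  by rewrite fct_sumE.
elim/big_ind: _ => [|f g cf cg|i _]; first exact: cvg_cst.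
- exact: cvgD.
- by apply: cvgZl; exact: exprn_continuous.
Qed.

Lemma vpoly_le n (c : 'I_n -> X) M t : `|t| <= M ->
  `|vpoly c t| <= \sum_(i < n) M ^+ i * `|c i|.
Proof.
move=> tM; rewrite (le_trans (ler_norm_sum _ _ _))// ler_sum// => i _.
by rewrite normrZ normrX ler_wpM2r// lerXn2r ?nnegrE// (le_trans _ tM).
Qed.

Lemma vpolyD n (c d : 'I_n -> X) t :
  vpoly (fun i => c i + d i) t = vpoly c t + vpoly d t.
Proof. by rewrite -big_split; apply: eq_bigr => i _; rewrite scalerDr. Qed.

Lemma hdot_scalarl (v : X) : scalar (hdot^~ v).
Proof. by move=> a x y; rewrite hdotDl hdotZl. Qed.

Lemma vpoly_inj n (c d : 'I_n -> X) x y : x < y ->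
  (forall t, t \in `]x, y[ -> vpoly c t = vpoly d t) -> c =1 d.
Proof.
move=> xy cd i; apply: hdot_inj => v.
have : lpoly (hdot^~ v) c = lpoly (hdot^~ v) d.
  by apply: (poly_eq_itv xy) => t /cd; rewrite !horner_lpoly//;
    [move=> ->|exact: hdot_scalarl..].
have cE (e : 'I_n -> X) : (lpoly (hdot^~ v) e)`_i = hdot (e i) v.
  rewrite coef_sum (bigD1 i)//= coefZ coefXn eqxx mulr1 big1 ?addr0// => j ji.
  by rewrite coefZ coefXn eq_sym (inj_eq val_inj) (negbTE ji) mulr0.
by move/polyP/(_ i); rewrite !cE.
Qed.

End vector_polynomials.

(** * Integrals and functions on a time grid *)

Section grid_integral.
Context {R : realType}.
Variables (tau : nat -> R) (N : nat).
Hypothesis tauS : forall n, (n < N)%N -> tau n < tau n.+1.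
Notation mu := (@lebesgue_measure R).

Lemma integrable_set1 (h : R -> R) x : mu.-integrable [set x] (EFin \o h).
Proof.
apply/integrableP; split; first exact: measurable_fun_set1.
by rewrite integral_set1.
Qed.

Lemma integrable_mull (a : R) (h : R -> R) (D : set R) : measurable D ->
  mu.-integrable D (EFin \o h) -> mu.-integrable D (EFin \o (fun t => a * h t)).
Proof. by move=> mD ih; apply: eq_integrable (integrableZl _ a ih). Qed.

Lemma integrable_mulr (a : R) (h : R -> R) (D : set R) : measurable D ->
  mu.-integrable D (EFin \o h) -> mu.-integrable D (EFin \o (fun t => h t * a)).
Proof. by move=> mD ih; apply: eq_integrable (integrableZr _ a ih). Qed.

Lemma integrable_Rsum (I : Type) (s : seq I) (f : I -> R -> R) (D : set R) :
  measurable D -> (forall i, mu.-integrable D (EFin \o f i)) ->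
  mu.-integrable D (EFin \o (fun t => \sum_(i <- s) f i t)).
Proof.
move=> mD fi; have : mu.-integrable D (fun t => \sum_(i <- s) (f i t)%:E)%E.
  by apply: integrable_sum => // i _; exact: fi.
by apply: eq_integrable => // t _ /=; rewrite sumEFin.
Qed.

Lemma Rintegral_sum (I : Type) (s : seq I) (f : I -> R -> R) (D : set R) :
  measurable D -> (forall i, mu.-integrable D (EFin \o f i)) ->
  \int[mu]_(t in D) (\sum_(i <- s) f i t) =
  \sum_(i <- s) \int[mu]_(t in D) f i t.
Proof.
move=> mD fi; elim: s => [|i s IH].
  rewrite big_nil; under eq_Rintegral do rewrite big_nil.
  by rewrite Rintegral_cst// mul0r.
rewrite big_cons -IH -RintegralD//; last exact: integrable_Rsum.
by apply: eq_Rintegral => t _; rewrite big_cons.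
Qed.

Lemma integrable_disj_setU (h : R -> R) (A B : set R) :
  measurable A -> measurable B -> [disjoint A & B] ->
  mu.-integrable A (EFin \o h) -> mu.-integrable B (EFin \o h) ->
  mu.-integrable (A `|` B) (EFin \o h).
Proof.
move=> mA mB AB /integrableP[hA iA] /integrableP[hB iB]; apply/integrableP.
have mAB : measurable_fun (A `|` B) (EFin \o h) by apply/measurable_funU.
split => //; rewrite ge0_integral_setU//; first exact: lte_add_pinfty.
exact: measurableT_comp.
Qed.

Lemma grid_integrable (h : R -> R) n : (n <= N)%N ->
  (forall i, (i < n)%N -> mu.-integrable `]tau i, tau i.+1[ (EFin \o h)) ->
  mu.-integrable `]tau 0%N, tau n[ (EFin \o h).
Proof.
move=> nN ih.
have tS i : (i < n)%N -> tau i < tau i.+1 by move=> /leq_trans/(_ nN)/tauS.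
apply: (grid_ind tS (K := fun D => mu.-integrable D (EFin \o h))) => //.
- exact: integrable_set0.
- exact: integrable_set1.
- exact: integrable_disj_setU.
Qed.

Lemma Rintegral_grid (h : R -> R) n : (n <= N)%N ->
  (forall i, (i < n)%N -> mu.-integrable `]tau i, tau i.+1[ (EFin \o h)) ->
  \int[mu]_(t in `]tau 0%N, tau n[) h t =
  \sum_(i < n) \int[mu]_(t in `]tau i, tau i.+1[) h t.
Proof.
elim: n => [|n IH] nN ih; first by rewrite big_ord0 set_itvoo0 Rintegral_set0.
rewrite big_ord_recr/= -IH//; [|exact: ltnW|by move=> i /ltnW; exact: ih].
have ihn : mu.-integrable `]tau 0%N, tau n[ (EFin \o h).
  by apply: grid_integrable (ltnW nN) _ => i /ltnW; exact: ih.
rewrite -(Rintegral_itvB (x := tau n) (grid_integrable nN ih)) ?bnd_simp; last 2 first.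
- by rewrite (grid_le tauS)// ltnW.
- exact: tauS.
by rewrite -(Rintegral_itv_bndo_bndc ihn) addrCA subrr addr0.
Qed.

End grid_integral.

Lemma glue {R : realType} {X : Type} (tau : nat -> R) (N : nat)
    (F : nat -> R -> X) : (forall n, (n < N)%N -> tau n < tau n.+1) -> exists w,
  w (tau 0%N) = F 0%N (tau 0%N) /\
  forall n, (n < N)%N -> forall t, t \in `]tau n, tau n.+1] -> w t = F n t.
Proof.
move=> tauS; have : forall n i, (i <= n)%N -> (n <= N)%N -> tau i <= tau n.
  by move=> n i; exact: grid_le.
elim: N {tauS} => [_|n IH tle]; first by exists (F 0%N).
have [i m im mn|w [w0 wF]] := IH.
  by apply: tle => //; exact: leqW.
exists (fun t => if t <= tau n then w t else F n t); split.
  by rewrite tle.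
move=> i; rewrite ltnS leq_eqVlt => /predU1P[->|ilt] t; rewrite in_itv/= => /andP[it ti].
  by rewrite leNgt it.
rewrite (le_trans ti); last by rewrite tle.
by apply: wF => //; rewrite in_itv/= it.
Qed.

(** * The L^2 projection onto piecewise polynomials *)

Lemma unitmx_row_ker {F : fieldType} n (A : 'M[F]_n) :
  (forall x : 'rV_n, x *m A = 0 -> x = 0) -> A \in unitmx.
Proof.
move=> Ax; rewrite -row_free_unit -kermx_eq0; apply/eqP/row_matrixP => i.
by rewrite row0; apply: Ax; rewrite -row_mul mulmx_ker row0.
Qed.

Lemma itv_norm_le {R : realType} (x y t : R) : t \in `]x, y[ -> `|t| <= `|x| + `|y|.
Proof.
rewrite in_itv/= => /andP[xt ty].
have := ler_norm (- x); have := ler_norm y; rewrite normrN ler_norml.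
by have := normr_ge0 x; have := normr_ge0 y; lra.
Qed.

Section L2_projection.
Context {R : realType} {X : hilbertType R}.
Variables (tau : nat -> R) (N : nat).
Hypothesis tau0 : tau 0%N = 0.
Hypothesis tauS : forall n, (n < N)%N -> tau n < tau n.+1.
Implicit Types (S : set X) (w : R -> X).
Notation mu := (@lebesgue_measure R).

Lemma pwpoly_L2 S m w : pwpoly tau N S m w -> L2 (tau N) w.
Proof.
move=> pw.
suff [sw [M wM]] : strongly_measurable_on `]0, tau N[ w /\
    exists M, forall t, `]0, tau N[%classic t -> `|w t| <= M.
  exact: (bounded_L2 (M := M)).
rewrite -{1 2}tau0; apply: (grid_ind tauS (K := fun D =>
  strongly_measurable_on D w /\ exists M, forall t, D t -> `|w t| <= M)) => //.
- by split; [exact: strongly_measurable_set0|exists 0].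
- move=> t; split; first exact: strongly_measurable_set1.
  by exists `|w t| => _ ->.
- move=> n nN; have [c [_ wc]] := pw n nN; split.
    apply: (@strongly_measurable_ext _ _ _ (vpoly c)).
      by move=> t /set_mem/wc ->.
    by apply: continuous_strongly_measurable => //; exact: continuous_vpoly.
  exists (\sum_(i < m.+1) (`|tau n| + `|tau n.+1|) ^+ i * `|c i|) => t tn.
  by rewrite wc//; apply: vpoly_le; exact: itv_norm_le.
- move=> A B mA mB AB [sA [M AM]] [sB [M' BM]]; split.
    exact: strongly_measurable_setU.
  exists (Num.max M M') => t [/AM|/BM] h.
    by rewrite le_max h.
  by rewrite le_max h orbT.
Qed.

Definition gram x y n : 'M[R]_n := \matrix_(i, j) pint x y ('X^i * 'X^j).

(** A vector in the kernel is the coefficient vector of a polynomial orthogonal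
    to all monomials of its degree. *)
Lemma gram_unitmx x y n : x < y -> gram x y n \in unitmx.
Proof.
move=> xy; apply: unitmx_row_ker => u uG.
pose p : {poly R} := \sum_(i < n) u 0 i *: 'X^i.
have sp : (size p <= n)%N.
  apply: (leq_trans (size_sum _ _ _)); apply/bigmax_leqP => i _.
  by rewrite (leq_trans (size_scale_leq _ _))// size_polyXn.
have /polyP p0 : p = 0.
  apply: (pint_orth xy sp) => j; move/matrixP/(_ 0 j) : uG.
  rewrite !mxE => <-; rewrite mulr_suml linear_sum; apply: eq_bigr => i _.
  by rewrite -scalerAl linearZ mxE.
apply/rowP => i; have := p0 i; rewrite coef_sum coef0 mxE => <-.
rewrite (bigD1 i)//= coefZ coefXn eqxx mulr1 big1 ?addr0// => j ji.
by rewrite coefZ coefXn eq_sym (inj_eq val_inj) (negbTE ji) mulr0.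
Qed.

Section one_interval.
Variables (T : R) (w : R -> X) (x y : R).
Hypotheses (w2 : L2 T w) (xy : x < y) (xyT : `]x, y[ `<=` `]0, T[).

Lemma integrable_moment v j :
  mu.-integrable `]x, y[ (EFin \o (fun t => hdot (w t) v * t ^+ j)).
Proof.
apply: (@L2_integrable_hdot _ _ T w v (fun t => t ^+ j) ((`|x| + `|y|) ^+ j)) => //.
by move=> t txy; rewrite normrX lerXn2r ?nnegrE ?addr_ge0 ?itv_norm_le.
Qed.

Definition moment j v := \int[mu]_(t in `]x, y[) (hdot (w t) v * t ^+ j).

Lemma moment_scalar j : scalar (moment j).
Proof.
move=> a u v; rewrite /moment -RintegralZl//; last exact: integrable_moment.
rewrite -RintegralD//; last exact: integrable_moment.
  by apply: eq_Rintegral => t _; rewrite hdotDr hdotZr; ring.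
by apply: integrable_mull => //; exact: integrable_moment.
Qed.

Lemma moment_bounded j : exists M, forall v, `|moment j v| <= M * `|v|.
Proof.
have iw : mu.-integrable `]x, y[ (EFin \o (fun t => `|w t|)).
  exact: integrableS (L2_integrable_norm w2).
pose C := (`|x| + `|y|) ^+ j.
exists (\int[mu]_(t in `]x, y[) `|w t| * C) => v.
apply: (le_trans (le_normr_Rintegral _ (integrable_moment v j))) => //.
rewrite -RintegralZr// -RintegralZr//; last by apply: integrable_mulr.
apply: le_Rintegral => //.
- exact: (integrable_norm (integrable_moment v j)).
- by do 2 apply: integrable_mulr => //.
move=> t txy; rewrite normrM [leRHS]mulrAC ler_pM ?cauchy_schwarz//.
by rewrite normrX lerXn2r ?nnegrE ?addr_ge0 ?itv_norm_le.
Qed.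

(** The moments of w against the monomials are bounded linear forms in the
    direction v, hence vectors of X by Riesz; the invertible Gram matrix of the
    monomials turns them into the coefficients of the projection. *)
Lemma projection_itv m : exists c : 'I_m -> X, forall v (j : 'I_m),
  \int[mu]_(t in `]x, y[) (hdot (w t) v * t ^+ j) =
  pint x y (lpoly (hdot^~ v) c * 'X^j).
Proof.
pose r (j : 'I_m) := riesz (Dual (moment_scalar j) (moment_bounded j)).
pose c i := \sum_(k < m) invmx (gram x y m) k i *: r k.
have rE (j : 'I_m) : \sum_(i < m) gram x y m i j *: c i = r j.
  rewrite /c; under eq_bigr do rewrite scaler_sumr.
  rewrite exchange_big (bigD1 j)//= [X in _ + X]big1 => [|k kj].
    rewrite addr0; under eq_bigr do rewrite scalerA mulrC.
    rewrite -scaler_suml.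
    have /matrixP/(_ j j) := mulVmx (gram_unitmx m xy).
    by rewrite !mxE eqxx => ->; rewrite scale1r.
  under eq_bigr do rewrite scalerA mulrC.
  rewrite -scaler_suml.
  have /matrixP/(_ k j) := mulVmx (gram_unitmx m xy).
  by rewrite !mxE (negbTE kj) => ->; rewrite scale0r.
exists c => v j.
transitivity (hdot (r j) v); first by rewrite -rieszE.
rewrite -rE (scalar_sum _ _ (hdot_scalarl v)) mulr_suml linear_sum.
by apply: eq_bigr => i _; rewrite -scalerAl linearZ mxE mulrC.
Qed.

Lemma integrable_moment_vpoly m (c : 'I_m -> X) v j :
  mu.-integrable `]x, y[
    (EFin \o (fun t => hdot (w t - vpoly c t) v * t ^+ j)).
Proof.
have ih : mu.-integrable `]x, y[ (fun t => (lpoly (hdot^~ v) c * 'X^j).[t]%:E).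
  exact: integrable_horner.
apply: eq_integrable (integrableB _ (integrable_moment v j) ih) => //.
move=> t _ /=; rewrite -EFinB hornerM hornerXn horner_lpoly.
  by rewrite hdotDl hdotNl mulrBl.
exact: hdot_scalarl.
Qed.

Lemma Rintegral_moment_vpoly m (c : 'I_m -> X) v j :
  \int[mu]_(t in `]x, y[) (hdot (w t - vpoly c t) v * t ^+ j) =
  \int[mu]_(t in `]x, y[) (hdot (w t) v * t ^+ j) -
    pint x y (lpoly (hdot^~ v) c * 'X^j).
Proof.
rewrite -Rintegral_horner// -RintegralB//; last 2 first.
- exact: integrable_moment.
- exact: integrable_horner.
apply: eq_Rintegral => t _; rewrite hornerM hornerXn horner_lpoly.
  by rewrite hdotDl hdotNl mulrBl.
exact: hdot_scalarl.
Qed.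

End one_interval.

(** This holds for any w: where no projection exists, [Pi0] is the zero
    function. *)
Lemma pwpoly_Pi0 m w : pwpoly tau N setT m (Pi0 tau N m w).
Proof.
rewrite /Pi0; case: xgetP => [W _ [pW _]|_]; first exact: pW.
move=> n nN.
exists (fun=> 0); split=> [//|t _].
rewrite big1// => i _; exact: scaler0.
Qed.

Lemma piece_sub n : (n < N)%N -> `]tau n, tau n.+1[ `<=` `]0, tau N[.
Proof. by move=> nN; rewrite -tau0; exact: (grid_itv_sub tauS). Qed.

Lemma Pi0_set_nonempty m w : L2 (tau N) w ->
  exists W, pwpoly tau N setT m W /\
    forall phi, pwpoly tau N setT m phi ->
      \int[mu]_(t in `]0, tau N[) hdot (w t - W t) (phi t) = 0.
Proof.
move=> w2.
have /choice[c cE] : forall n, exists c : 'I_m.+1 -> X, (n < N)%N ->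
    forall v (j : 'I_m.+1),
    \int[mu]_(t in `]tau n, tau n.+1[) (hdot (w t) v * t ^+ j) =
    pint (tau n) (tau n.+1) (lpoly (hdot^~ v) c * 'X^j).
  move=> n; have [nN|_] := ltnP n N; last by exists (fun=> 0).
  by have [c cE] := projection_itv w2 (tauS nN) (piece_sub nN) m.+1; exists c.
have [W [_ Wc]] := glue (fun n => vpoly (c n)) tauS.
have WE n : (n < N)%N -> {in `]tau n, tau n.+1[, W =1 vpoly (c n)}.
  by move=> nN t; rewrite in_itv/= => /andP[nt tn]; apply: Wc => //; rewrite in_itv/= nt ltW.
exists W; split=> [n nN|phi pphi].
  by exists (c n); split => // t /(WE _ nN).
have phiE n : (n < N)%N -> exists d : 'I_m.+1 -> X,
    forall t, t \in `]tau n, tau n.+1[ ->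
      hdot (w t - W t) (phi t) =
      \sum_(j < m.+1) hdot (w t - vpoly (c n) t) (d j) * t ^+ j.
  move=> nN; have [d [_ dE]] := pphi n nN; exists d => t tn.
  rewrite dE// (WE n)// (scalar_sum _ _ (hdot_dual_scalar _)).
  by apply: eq_bigr => j _; rewrite mulrC.
have iE n (d : 'I_m.+1 -> X) (j : 'I_m.+1) : (n < N)%N ->
    mu.-integrable `]tau n, tau n.+1[ (EFin \o (fun t =>
      hdot (w t - vpoly (c n) t) (d j) * t ^+ j)).
  by move=> nN; apply: integrable_moment_vpoly w2 _ _ _ _ _; exact: piece_sub.
rewrite -{1}tau0 (Rintegral_grid tauS)// => [|n nN]; last first.
  have [d dE] := phiE n nN.
  have : mu.-integrable `]tau n, tau n.+1[ (EFin \o (fun t =>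
      \sum_(j < m.+1) hdot (w t - vpoly (c n) t) (d j) * t ^+ j)).
    by apply: integrable_Rsum => // j; exact: iE.
  by apply: eq_integrable => // t /set_mem tn /=; rewrite dE.
apply: big1 => n _; have nN := ltn_ord n; have [d dE] := phiE n nN.
transitivity (\int[mu]_(t in `]tau n, tau n.+1[)
    (\sum_(j < m.+1) hdot (w t - vpoly (c n) t) (d j) * t ^+ j)).
  by apply: eq_Rintegral => t /set_mem/dE.
rewrite Rintegral_sum//; last by move=> j; exact: iE.
apply: big1 => j _; rewrite (Rintegral_moment_vpoly w2 (tauS nN) (piece_sub nN)).
by rewrite cE// subrr.
Qed.

(** Orthogonality tested with one monomial on one time interval, the form in
    which it is used from here on. *)
Lemma Pi0_moments m w n (c : 'I_m.+1 -> X) : L2 (tau N) w -> (n < N)%N ->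
  (forall t, t \in `]tau n, tau n.+1[ -> Pi0 tau N m w t = vpoly c t) ->
  forall v (j : 'I_m.+1),
  \int[mu]_(t in `]tau n, tau n.+1[) (hdot (w t) v * t ^+ j) =
  pint (tau n) (tau n.+1) (lpoly (hdot^~ v) c * 'X^j).
Proof.
move=> w2 nN Wc v j.
have [_ orth] := xgetPex (fun=> 0) (Pi0_set_nonempty m w2).
apply/eqP; rewrite -subr_eq0 -(Rintegral_moment_vpoly w2 (tauS nN) (piece_sub nN)).
pose phi t := if t \in `]tau n, tau n.+1[ then t ^+ j *: v else 0.
have phi0 i t : (i < N)%N -> i != n -> t \in `]tau i, tau i.+1[ -> phi t = 0.
  move=> iN i_n ti; rewrite /phi; case: ifP => // tn; exfalso; move: i_n.
  rewrite neq_ltn => /orP[i_n|n_i].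
    have := grid_le tauS i_n (ltnW nN); move: ti tn; rewrite !in_itv/=; lra.
  have := grid_le tauS n_i (ltnW iN); move: ti tn; rewrite !in_itv/=; lra.
have pphi : pwpoly tau N setT m phi.
  move=> i iN; exists (fun k => if (i == n) && (k == j) then v else 0); split => //.
  move=> t ti; case: (eqVneq i n) => [i_n|i_n] /=.
    rewrite /phi -i_n ti (bigD1 j)//= eqxx big1 ?addr0// => k /negbTE->.
    by rewrite scaler0.
  by rewrite (phi0 i)// big1 // => k _; rewrite scaler0.
apply/eqP; rewrite -[RHS](orth phi pphi) -/(Pi0 tau N m w).
pose h t := hdot (w t - vpoly c t) v * t ^+ j.
have hn t : t \in `]tau n, tau n.+1[ -> hdot (w t - Pi0 tau N m w t) (phi t) = h t.
  by move=> tn; rewrite /phi tn Wc// hdotZr mulrC.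
have hi i t : (i < N)%N -> i != n -> t \in `]tau i, tau i.+1[ ->
    hdot (w t - Pi0 tau N m w t) (phi t) = 0.
  by move=> iN i_n ti; rewrite (phi0 i)// hdotC hdot0l.
rewrite -[in RHS]tau0 (Rintegral_grid tauS)// => [|i iN]; last first.
  have [i_n|i_n] := eqVneq i n.
    have : mu.-integrable `]tau n, tau n.+1[ (EFin \o h).
      by apply: integrable_moment_vpoly w2 _ _ _ _ _; exact: piece_sub.
    by rewrite i_n; apply: eq_integrable => // t /set_mem tn /=; rewrite hn.
  have := integrable0 mu `]tau i, tau i.+1[%classic.
  by apply: eq_integrable => // t /set_mem ti /=; rewrite (hi i).
rewrite (bigD1 (Ordinal nN))//= [X in _ + X]big1 => [|i i_n].
  by rewrite addr0; apply: eq_Rintegral => t /set_mem tn; rewrite hn.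
transitivity (\int[mu]_(t in `]tau i, tau i.+1[) (cst 0 t : R)).
  by apply: eq_Rintegral => t /set_mem ti; rewrite (hi i).
by rewrite Rintegral_cst// mul0r.
Qed.

End L2_projection.

(** * A continuously differentiable step function *)

Section derivatives.
Context {R : realType} {X : normedModType R}.

Lemma is_derive_cvg (f : R -> X) x d :
  h^-1 *: (f (h + x) - f x) @[h --> 0^'] --> d -> is_derive x 1 f d.
Proof.
move=> fd; have fd' : h^-1 *: ((f \o shift x) (h *: 1) - f x) @[h --> 0^'] --> d.
  by under eq_fun do rewrite /= /GRing.scale/= mulr1.
by apply: DeriveDef; [apply/cvg_ex; exists d|exact: cvg_lim].
Qed.

(** Used for the squared positive part, whose first order Taylor remainder is
    at most h^2 on either side of the junction. *)
Lemma is_derive_quadratic (f : R -> X) x d C :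
  (forall h, `|f (h + x) - f x - h *: d| <= C * h ^+ 2) -> is_derive x 1 f d.
Proof.
move=> fC; apply: is_derive_cvg; apply/cvgrPdist_le => e e0; near=> h.
have h0 : h != 0 by near: h; exact: nbhs_dnbhs_neq.
rewrite -[d](scalerK h0) -scalerBr normrZ distrC normfV.
rewrite -ler_pdivlMl ?invr_gt0 ?normr_gt0// invrK (le_trans (fC h))//.
apply: (@le_trans _ _ (`|h| * ((`|C| + 1) * `|h|))).
  have -> : `|h| * ((`|C| + 1) * `|h|) = (`|C| + 1) * h ^+ 2.
    by rewrite -[h ^+ 2]real_normK ?num_real//; ring.
  rewrite ler_wpM2r ?sqr_ge0//.
  by rewrite (le_trans (ler_norm C))// lerDl.
rewrite ler_wpM2l// -ler_pdivlMl ?ltr_wpDl//.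
near: h; apply: dnbhs0_le; rewrite mulr_gt0 ?invr_gt0 ?ltr_wpDl//.
Unshelve. all: by end_near. Qed.

Lemma is_derive_scalel (f : R -> R) (c : X) (x d : R) :
  is_derive x 1 f d -> is_derive x 1 (fun t => f t *: c) (d *: c).
Proof.
move=> [df dE]; apply: is_derive_cvg.
under eq_fun do rewrite -scalerBl scalerA.
apply: cvgZl; rewrite -dE; move/cvg_ex: df => [l dl].
have : h^-1 *: ((f \o shift x) (h *: 1) - f x) @[h --> 0^'] --> 'D_1 f x.
  by rewrite /derive (cvg_lim _ dl).
by under eq_fun do rewrite /= /GRing.scale/= mulr1.
Qed.

End derivatives.

Section spline.
Context {R : realType}.
Implicit Types (c e x t : R).

Definition pospart x : R := Num.max x 0.

Lemma continuous_pospart c : continuous (fun t => pospart (t - c)).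
Proof.
move=> t; apply: (@continuous_max _ _ (fun s : R => s - c) (cst 0)).
  by apply: cvgB; [exact: cvg_id|exact: cvg_cst].
exact: cvg_cst.
Qed.

Lemma is_derive_pospart2 c t :
  is_derive t 1 (fun s => pospart (s - c) ^+ 2) (2 * pospart (t - c)).
Proof.
apply: (@is_derive_quadratic _ _ _ _ _ 1) => h; rewrite mul1r /GRing.scale/=.
rewrite -(addrA h t); move: (t - c) => x; rewrite /pospart ler_norml.
case: (leP (h + x) 0) => hx; case: (leP x 0) => x0; apply/andP; split; nra.
Qed.

(** A C^1 quadratic spline rising from 0 to 1 between 0 and [e]. It combines
    three translates of the squared positive part, each of which is C^1 on the
    whole line. *)
Definition step e t : R :=
  (e ^+ 2 / 2)^-1 * (pospart (t - 0) ^+ 2 - 2 * pospart (t - e / 2) ^+ 2 +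
                     pospart (t - e) ^+ 2).
Definition dstep e t : R :=
  (e ^+ 2 / 2)^-1 * (2 * pospart (t - 0) - 2 * (2 * pospart (t - e / 2)) +
                     2 * pospart (t - e)).

Lemma is_derive_step e t : is_derive t 1 (step e) (dstep e t).
Proof.
have d0 := is_derive_pospart2 0 t; have d1 := is_derive_pospart2 (e / 2) t.
have d2 := is_derive_pospart2 e t.
by apply: (is_deriveZ (e ^+ 2 / 2)^-1); apply: is_deriveD; apply: is_deriveB.
Qed.

Lemma continuous_dstep e : continuous (dstep e).
Proof.
move=> t; apply: cvgM; first exact: cvg_cst.
have c0 := @continuous_pospart 0 t; have c1 := @continuous_pospart (e / 2) t.
have c2 := @continuous_pospart e t.
apply: cvgD; last by apply: cvgM c2; exact: cvg_cst.
apply: cvgB; first by apply: cvgM c0; exact: cvg_cst.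
by apply: cvgM; [exact: cvg_cst|apply: cvgM c1; exact: cvg_cst].
Qed.

Lemma step_le0 e t : 0 < e -> t <= 0 -> step e t = 0 /\ dstep e t = 0.
Proof.
move=> e0 t0; rewrite /step /dstep /pospart !max_r; [|lra..].
by split; ring.
Qed.

Lemma step_ge e t : 0 < e -> e <= t -> step e t = 1 /\ dstep e t = 0.
Proof.
move=> e0 et; rewrite /step /dstep /pospart !max_l; [|lra..].
by split; field; rewrite gt_eqF.
Qed.

Lemma step_itv e t : 0 < e -> 0 <= step e t <= 1 /\ 0 <= dstep e t.
Proof.
move=> e0; have [t0|t0] := leP t 0.
  by have [-> ->] := step_le0 e0 t0; rewrite lexx ler01.
have [et|te] := leP e t.
  by have [-> ->] := step_ge e0 et; rewrite lexx ler01.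
have e2 : 0 < e ^+ 2 / 2 by rewrite divr_gt0// exprn_gt0.
rewrite /step /dstep /pospart subr0 (max_l (ltW t0)).
rewrite (max_r (_ : t - e <= 0)); last by lra.
rewrite ler_pdivrMl// mulr1 !pmulr_rge0 ?invr_gt0//.
case: (leP (t - e / 2) 0) => h; split; [apply/andP; split| |apply/andP; split|]; nra.
Qed.

End spline.

(** * Increments of functions with a weak derivative *)

Section weak_ftc.
Context {R : realType}.
Implicit Types (e a s r t c eta : R) (u v : R -> R).
Notation mu := (@lebesgue_measure R).

Lemma is_derive_step_shift e a t :
  is_derive t 1 (fun t => step e (t - a)) (dstep e (t - a)).
Proof.
have ds := @is_derive1_comp R (step e) (fun t => t - a) t _ 1 (is_derive_step e (t - a)).
rewrite -[dstep _ _]mulr1; apply: ds.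
by have := @is_deriveB R R R id (cst a) t 1 1 0 _ _; rewrite subr0; apply.
Qed.

Lemma continuous_dstep_shift e a : continuous (fun t => dstep e (t - a)).
Proof.
move=> t; apply: (@continuous_comp _ _ _ (fun s => s - a) (dstep e)).
  by apply: cvgB; [exact: cvg_id|exact: cvg_cst].
exact: continuous_dstep.
Qed.

Lemma Rintegral_dstep T e a : 0 < T -> 0 < e -> 0 <= a -> a + e <= T ->
  \int[mu]_(t in `]0, T[) dstep e (t - a) = 1.
Proof.
move=> T0 e0 a0 aT.
have dstepE t : derive1 (fun t => step e (t - a)) t = dstep e (t - a).
  by rewrite derive1E; exact: (derive_val (is_derive := is_derive_step_shift e a t)).
have cstep : continuous (fun t => step e (t - a)).
  move=> t; apply: differentiable_continuous; apply/derivable1_diffP.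
  exact: (ex_derive (is_derive := is_derive_step_shift e a t)).
rewrite -Rintegral_itvoo_itvcc; last first.
  apply: within_continuous_integrable.
  by apply: continuous_subspaceT; exact: continuous_dstep_shift.
rewrite /Rintegral (continuous_FTC2 (F := fun t => step e (t - a)))//.
- have [-> _] : step e (T - a) = 1 /\ dstep e (T - a) = 0 by apply: step_ge; lra.
  have [-> _] : step e (0 - a) = 0 /\ dstep e (0 - a) = 0 by apply: step_le0; lra.
  by rewrite /= subr0.
- by apply: continuous_subspaceT; exact: continuous_dstep_shift.
- split=> [t _||]; first exact: (ex_derive (is_derive := is_derive_step_shift e a t)).
  + exact/cvg_at_right_filter/cstep.
  + exact/cvg_at_left_filter/cstep.
Qed.

Lemma integrable_within_dstep T e a u : {within `[0, T], continuous u} ->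
  mu.-integrable `]0, T[ (EFin \o (fun t => u t * dstep e (t - a))).
Proof.
move=> cu; apply: within_continuous_integrable.
have cd : {within `[0, T], continuous (fun t => dstep e (t - a))}.
  by apply: continuous_subspaceT; exact: continuous_dstep_shift.
by move=> t; apply: cvgM; [exact: cu|exact: cd].
Qed.

(** Against the bump [dstep], of mass 1 on [a, a + e], a function oscillating
    little there integrates to nearly its value. *)
Lemma dstep_average T e a c eta u : 0 < T -> {within `[0, T], continuous u} ->
  0 < e -> 0 <= a -> a + e <= T ->
  (forall t, t \in `[a, a + e] -> `|u t - c| <= eta) ->
  `|\int[mu]_(t in `]0, T[) (u t * dstep e (t - a)) - c| <= eta.
Proof.
move=> T0 cu e0 a0 aT uc.
have id1 : mu.-integrable `]0, T[ (EFin \o (fun t => dstep e (t - a))).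
  have := @integrable_within_dstep T e a (cst 1) _.
  under [X in EFin \o X]eq_fun do rewrite mul1r; apply.
  by move=> t; exact: cvg_cst.
have -> : \int[mu]_(t in `]0, T[) (u t * dstep e (t - a)) - c =
    \int[mu]_(t in `]0, T[) ((u t - c) * dstep e (t - a)).
  rewrite -[c in LHS]mulr1 -(Rintegral_dstep T0 e0 a0 aT) -RintegralZl// -RintegralB//.
  - by apply: eq_Rintegral => t _; rewrite mulrBl.
  - exact: integrable_within_dstep.
  - exact: integrable_mull.
have iuc : mu.-integrable `]0, T[ (EFin \o (fun t => (u t - c) * dstep e (t - a))).
  apply: integrable_within_dstep => t; apply: cvgB; first exact: cu.
  exact: cvg_cst.
apply: (le_trans (le_normr_Rintegral _ iuc)) => //.
rewrite -[eta]mulr1 -(Rintegral_dstep T0 e0 a0 aT) -RintegralZl//.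
apply: le_Rintegral => //.
- exact: (integrable_norm iuc).
- exact: integrable_mull.
move=> t _; rewrite normrM.
have [ta|ta] := boolP (t \in `[a, a + e]).
  have [_ d0] := step_itv (t - a) e0.
  by rewrite [X in _ * X]ger0_norm// ler_wpM2r// uc.
suff -> : dstep e (t - a) = 0 by rewrite normr0 !mulr0.
move: ta; rewrite in_itv/= negb_and -!ltNge => /orP[ta|ta].
  by have [_ ->] : step e (t - a) = 0 /\ dstep e (t - a) = 0 by apply: step_le0; lra.
by have [_ ->] : step e (t - a) = 1 /\ dstep e (t - a) = 0 by apply: step_ge; lra.
Qed.

(** A C^1 trapezoid, 1 on [s + 2e, r - 2e] and 0 outside [s + e, r - e]. *)
Definition trapezoid e s r t := step e (t - (s + e)) - step e (t - (r - 2 * e)).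

Lemma is_derive_trapezoid e s r t :
  is_derive t 1 (trapezoid e s r) (dstep e (t - (s + e)) - dstep e (t - (r - 2 * e))).
Proof. by apply: is_deriveB; exact: is_derive_step_shift. Qed.

Lemma trapezoid_out e s r t : 0 < e -> 4 * e <= r - s -> t \notin `[s + e, r - e] ->
  trapezoid e s r t = 0.
Proof.
move=> e0 esr; rewrite /trapezoid in_itv/= negb_and -!ltNge => /orP[ts|rt].
  rewrite (step_le0 _ _).1 ?(step_le0 _ _).1; lra.
rewrite (step_ge _ _).1 ?(step_ge _ _).1; lra.
Qed.

Lemma trapezoid_bound e s r t : 0 < e -> `|trapezoid e s r t| <= 1.
Proof.
move=> e0; have [/andP[? ?] _] := step_itv (t - (s + e)) e0.
have [/andP[? ?] _] := step_itv (t - (r - 2 * e)) e0.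
by rewrite /trapezoid ler_norml; apply/andP; split; lra.
Qed.

Lemma trapezoid_in e s r t : 0 < e -> s + 2 * e <= t -> t <= r - 2 * e ->
  trapezoid e s r t = 1.
Proof.
move=> e0 st tr; rewrite /trapezoid (step_ge _ _).1; [|lra..].
by rewrite (step_le0 _ _).1 ?subr0; lra.
Qed.

Lemma test_function_trapezoid T e s r : 0 <= s -> r <= T -> 0 < e ->
  4 * e <= r - s -> test_function T (trapezoid e s r).
Proof.
move=> s0 rT e0 esr; split.
- by move=> t; exact: (ex_derive (is_derive := is_derive_trapezoid e s r t)).
- rewrite (_ : derive1 _ =
      (fun t => dstep e (t - (s + e)) - dstep e (t - (r - 2 * e)))).
    by move=> t; apply: cvgB; exact: continuous_dstep_shift.
  apply/funext => t; rewrite derive1E.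
  exact: (derive_val (is_derive := is_derive_trapezoid e s r t)).
- exists (s + e), (r - e); split; [lra..|].
  by move=> t; exact: trapezoid_out.
Qed.

Lemma within_cvg_near (X : normedModType R) T (u : R -> X) s eta :
  {within `[0, T], continuous u} ->
  0 <= s -> s <= T -> 0 < eta ->
  exists2 delta, 0 < delta &
    forall t, 0 <= t -> t <= T -> `|t - s| < delta -> `|u t - u s| <= eta.
Proof.
move=> /subspace_continuousP cu s0 sT eta0.
have /cvgrPdist_le/(_ eta eta0) : u @ within `[0, T] (nbhs s) --> u s.
  by apply: cu; rewrite /= in_itv/= s0.
rewrite near_withinE => /nbhs_ballP[delta /= delta0 H]; exists delta => // t t0 tT ts.
rewrite distrC; apply: H; last by rewrite /= in_itv/= t0.
by rewrite -ball_normE /ball_/= distrC.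
Qed.

Lemma trapezoid_average T e s r eta u : {within `[0, T], continuous u} ->
  0 <= s -> r <= T -> 0 < e -> 4 * e <= r - s ->
  (forall t, s <= t -> t <= s + 2 * e -> `|u t - u s| <= eta / 2) ->
  (forall t, r - 2 * e <= t -> t <= r -> `|u t - u r| <= eta / 2) ->
  `|\int[mu]_(t in `]0, T[) (u t * derive1 (trapezoid e s r) t) - (u s - u r)|
    <= eta.
Proof.
move=> cu s0 rT e0 esr us ur.
have -> : \int[mu]_(t in `]0, T[) (u t * derive1 (trapezoid e s r) t) =
    \int[mu]_(t in `]0, T[) (u t * dstep e (t - (s + e))) -
    \int[mu]_(t in `]0, T[) (u t * dstep e (t - (r - 2 * e))).
  rewrite -RintegralB//; [|exact: integrable_within_dstep..].
  apply: eq_Rintegral => t _; rewrite -mulrBr derive1E.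
  by rewrite (derive_val (is_derive := is_derive_trapezoid e s r t)).
have T0 : 0 < T by lra.
have se0 : 0 <= s + e by lra.
have seT : s + e + e <= T by lra.
have re0 : 0 <= r - 2 * e by lra.
have reT : r - 2 * e + e <= T by lra.
have As : `|\int[mu]_(t in `]0, T[) (u t * dstep e (t - (s + e))) - u s| <= eta / 2.
  apply: dstep_average => // t; rewrite in_itv/= => /andP[t1 t2].
  by apply: us; clear -t1 t2 e0; lra.
have Ar : `|\int[mu]_(t in `]0, T[) (u t * dstep e (t - (r - 2 * e))) - u r|
    <= eta / 2.
  apply: dstep_average => // t; rewrite in_itv/= => /andP[t1 t2].
  by apply: ur; clear -t1 t2 e0; lra.
suff gen (A B x y : R) : `|A - x| <= eta / 2 -> `|B - y| <= eta / 2 ->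
    `|A - B - (x - y)| <= eta by exact: gen.
move=> Ax By; have -> : A - B - (x - y) = (A - x) - (B - y) by ring.
by rewrite (le_trans (ler_normB _ _))// (splitr eta) lerD.
Qed.

(** The weak derivative is only known against C^1 functions with compact
    support; trapezoids converging to the indicator of ]s, r[ recover the
    increments of the continuous representative. *)
Lemma weak_derivative_increment T u v s r : {within `[0, T], continuous u} ->
  mu.-integrable `]0, T[ (EFin \o v) ->
  (forall phi, test_function T phi ->
    \int[mu]_(t in `]0, T[) (u t * derive1 phi t) =
    - \int[mu]_(t in `]0, T[) (v t * phi t)) ->
  0 <= s -> s < r -> r <= T ->
  \int[mu]_(t in `]s, r[) v t = u r - u s.
Proof.
move=> cu iv uv s0 sr rT; have T0 : 0 < T by lra.
(* The factor 1/4 leaves room for both ramps of the trapezoid. *)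
pose e n := (r - s) / 4 * n.+1%:R^-1.
have e0 n : 0 < e n by rewrite /e; apply: mulr_gt0; [lra|rewrite invr_gt0].
have e4 n : 4 * e n <= r - s.
  have : n.+1%:R^-1 <= 1 :> R by rewrite invf_le1// ler1n.
  by rewrite /e; move: (n.+1%:R^-1) => h h1; nra.
have ecvg : e @ \oo --> (0 : R).
  rewrite -(mulr0 ((r - s) / 4)); apply: cvgM; first exact: cvg_cst.
  exact: cvg_harmonic.
clearbody e; pose phi n := trapezoid (e n) s r.
have lhs : (fun n => \int[mu]_(t in `]0, T[) (u t * derive1 (phi n) t)) @ \oo
    --> u s - u r.
  apply/cvgrPdist_le => eta eta0.
  have eta2 : 0 < eta / 2 by rewrite divr_gt0.
  have [ds ds0 us] := within_cvg_near cu s0 (ltW (lt_le_trans sr rT)) eta2.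
  have [dr dr0 ur] := within_cvg_near cu (ltW (le_lt_trans s0 sr)) rT eta2.
  near=> n.
  have nds : 2 * e n < ds.
    rewrite -ltr_pdivlMl//; near: n; apply: (cvgr_lt 0 ecvg).
    by rewrite mulr_gt0// invr_gt0.
  have ndr : 2 * e n < dr.
    rewrite -ltr_pdivlMl//; near: n; apply: (cvgr_lt 0 ecvg).
    by rewrite mulr_gt0// invr_gt0.
  have en0 := e0 n; have en4 := e4 n.
  rewrite distrC; apply: trapezoid_average => // t t1 t2.
  - by apply: us; rewrite ?ltr_norml;
      clear -t1 t2 nds en0 en4 s0 rT; try (apply/andP; split); lra.
  - by apply: ur; rewrite ?ltr_norml;
      clear -t1 t2 ndr en0 en4 s0 rT; try (apply/andP; split); lra.
have sub : `]s, r[ `<=` `]0, T[ by apply: subset_itv; rewrite bnd_simp.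
have iv' : mu.-integrable `]s, r[ (EFin \o v) by apply: integrableS iv.
have rhs : (fun n => \int[mu]_(t in `]0, T[) (v t * phi n t)) @ \oo -->
    \int[mu]_(t in `]s, r[) v t.
  have -> : (fun n => \int[mu]_(t in `]0, T[) (v t * phi n t)) =
      (fun n => \int[mu]_(t in `]s, r[) (v t * phi n t)).
    apply/funext => n.
    rewrite [in RHS](_ : `]s, r[%classic = `]0, T[ `&` `]s, r[); last first.
      by rewrite setIC; apply/esym/setIidPl.
    rewrite Rintegral_mkcondr; apply: eq_Rintegral => t _; rewrite patchE.
    case: ifPn => // /negP tsr; rewrite /phi trapezoid_out ?mulr0//.
    apply/negP => tin; apply: tsr; rewrite inE/=.
    have := e0 n; move: tin; rewrite !in_itv/=; lra.
  have mphi n D : measurable_fun D (phi n).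
    apply: (@measurable_funS _ _ _ _ setT) => //.
    apply: continuous_measurable_fun => t.
    apply: differentiable_continuous; apply/derivable1_diffP.
    exact: (ex_derive (is_derive := is_derive_trapezoid (e n) s r t)).
  have mv : measurable_fun `]s, r[ v.
    by apply/measurable_EFinP; exact: (measurable_int mu).
  have cvgE : (fun n => \int[mu]_(t in `]s, r[) (v t * phi n t)%:E)%E @ \oo -->
      (\int[mu]_(t in `]s, r[) (v t)%:E)%E.
    have mf n : measurable_fun `]s, r[ (EFin \o (fun t => v t * phi n t)).
      by apply/measurable_EFinP; exact: measurable_funM.
    have mf' : measurable_fun `]s, r[ (EFin \o v) by exact/measurable_EFinP.
    have cf : {ae mu, forall t, `]s, r[%classic t ->
        (EFin \o (fun t => v t * phi n t)) t @[n --> \oo] --> (EFin \o v) t}.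
      apply: aeW => t; rewrite /= in_itv/= => /andP[st tr]; apply: cvg_EFin.
        exact: nearW.
      rewrite -[v t in X in _ --> X]mulr1; apply: cvgM; first exact: cvg_cst.
      apply: cvg_near_cst; near=> n; apply: trapezoid_in => //.
        rewrite -lerBrDl -ler_pdivlMl//; near: n; apply: (cvgr_le 0 ecvg).
        by rewrite mulr_gt0 ?invr_gt0 ?subr_gt0.
      rewrite lerBrDr -lerBrDl -ler_pdivlMl//; near: n; apply: (cvgr_le 0 ecvg).
      by rewrite mulr_gt0 ?invr_gt0 ?subr_gt0.
    have bf : {ae mu, forall t n, `]s, r[%classic t ->
        (`|(v t * phi n t)%:E| <= `|(v t)%:E|)%E}.
      apply: aeW => t n _ /=; rewrite lee_fin normrM ler_piMr//.
      exact: trapezoid_bound.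
    by have [_ _] := @dominated_convergence _ _ R mu _ (measurable_itv _) _ _ _
      mf mf' cf (integrable_abse iv') bf.
  have fv : (\int[mu]_(t in `]s, r[) (v t)%:E)%E \is a fin_num.
    exact: integrable_fin_num.
  by rewrite -(fineK fv) in cvgE; exact: (fine_cvg cvgE).
have rhs' : (fun n => \int[mu]_(t in `]0, T[) (u t * derive1 (phi n) t)) @ \oo
    --> - \int[mu]_(t in `]s, r[) v t.
  rewrite (_ : (fun n => _) =
      (fun n => - \int[mu]_(t in `]0, T[) (v t * phi n t))); first exact: cvgN.
  by apply/funext => n; apply: uv; exact: test_function_trapezoid.
have incr : u s - u r = - \int[mu]_(t in `]s, r[) v t.
  exact: cvg_unique lhs rhs'.
by apply: oppr_inj; rewrite -incr opprB.
Unshelve. all: by end_near. Qed.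

End weak_ftc.

(** * Continuous piecewise polynomials and the interpolation Pi^1 *)

Section derivative_of_vpoly.
Context {R : realType} {X : hilbertType R}.

Definition dcoef m (c : 'I_m.+1 -> X) : 'I_m -> X :=
  fun i => i.+1%:R *: c (lift ord0 i).

(** The coefficients of the polynomial with value [u] at [al] whose nonconstant
    coefficients are [d]. *)
Definition startcoef m (al : R) (u : X) (d : 'I_m -> X) : 'I_m.+1 -> X :=
  fun i => if unlift ord0 i is Some j then d j
           else u - \sum_(j < m) al ^+ j.+1 *: d j.

Lemma vpoly_recl m (c : 'I_m.+1 -> X) t :
  vpoly c t = c ord0 + \sum_(j < m) t ^+ j.+1 *: c (lift ord0 j).
Proof. by rewrite /vpoly big_ord_recl expr0 scale1r. Qed.

Lemma vpoly_startcoef m al u (d : 'I_m -> X) t :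
  vpoly (startcoef al u d) t =
  u + \sum_(j < m) (t ^+ j.+1 - al ^+ j.+1) *: d j.
Proof.
rewrite vpoly_recl /startcoef unlift_none -addrA; congr (_ + _).
rewrite addrC -sumrB; apply: eq_bigr => j _.
by rewrite liftK scalerBl.
Qed.

Lemma vpoly_startE m al (c : 'I_m.+1 -> X) t :
  vpoly c t = vpoly c al +
    \sum_(j < m) (t ^+ j.+1 - al ^+ j.+1) *: c (lift ord0 j).
Proof.
rewrite [X in X + _]vpoly_recl vpoly_recl -addrA; congr (_ + _).
rewrite -big_split; apply: eq_bigr => j _ /=.
by rewrite -scalerDl addrC subrK.
Qed.

Lemma vpoly_dcoefE m (c : 'I_m.+1 -> X) t :
  vpoly (dcoef c) t = \sum_(i < m.+1) ('X^i)^`().[t] *: c i.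
Proof.
rewrite big_ord_recl derivXn mulr0n horner0 scale0r add0r; apply: eq_bigr => i _.
by rewrite derivXn hornerMn hornerXn scalerA /= mulr_natr.
Qed.

Lemma is_derive_vpoly m (c : 'I_m.+1 -> X) t :
  is_derive (t : R) (1 : R) (vpoly c) (vpoly (dcoef c) t).
Proof.
have -> : vpoly c = \sum_(i < m.+1) (fun s => ('X^i).[s] *: c i).
  by apply/funext => s; rewrite fct_sumE; apply: eq_bigr => i _; rewrite hornerXn.
by rewrite vpoly_dcoefE; apply: is_derive_sum => i; apply: is_derive_scalel; exact: is_derive_poly.
Qed.

Lemma lpoly_dcoef (l : X -> R) m (c : 'I_m.+1 -> X) : scalar l ->
  lpoly l (dcoef c) = (lpoly l c)^`().
Proof.
move=> ll; apply: (@poly_eq_itv _ 0 1 _ _ ltr01) => t _.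
rewrite horner_lpoly// linear_sum big_ord_recl /= linearZ /= derivXn mulr0n scaler0 add0r.
rewrite horner_sum /vpoly scalar_sum//; apply: eq_bigr => i _.
rewrite linearZ/= derivXn hornerZ hornerMn hornerXn /dcoef.
have -> : l (i.+1%:R *: c (lift ord0 i)) = i.+1%:R * l (c (lift ord0 i)).
  have := @scalar_sum _ _ l 'I_1 (fun=> i.+1%:R) (fun=> c (lift ord0 i)) ll.
  by rewrite !big_ord1.
by rewrite /= /bump leq0n add0n add1n -[_ *+ i.+1]mulr_natr; ring.
Qed.

End derivative_of_vpoly.

Lemma derive1_eq_vpoly {R : realType} {X : hilbertType R} m (c : 'I_m.+1 -> X)
    (w : R -> X) x y t : (forall s, s \in `]x, y[ -> w s = vpoly c s) ->
  t \in `]x, y[ -> derive1 w t = vpoly (dcoef c) t.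
Proof.
move=> wc txy; rewrite derive1E.
have dc := is_derive_vpoly c t.
suff dw : is_derive (t : R) (1 : R) w (vpoly (dcoef c) t).
  exact: (derive_val (is_derive := dw)).
apply: near_eq_is_derive dc; near=> s; rewrite wc//; near: s.
by apply: near_in_itvoo.
Unshelve. all: by end_near. Qed.

Section continuous_pieces.
Context {R : realType} {X : hilbertType R}.
Variables (tau : nat -> R) (N : nat).
Hypothesis tau0 : tau 0%N = 0.
Hypothesis tauS : forall n, (n < N)%N -> tau n < tau n.+1.
Notation mu := (@lebesgue_measure R).

(** A piecewise polynomial that is continuous on [0, T] satisfies its polynomial
    formulas up to the nodes. *)
Lemma within_eq_itvcc T (w p : R -> X) x y : {within `[0, T], continuous w} ->
  continuous p -> 0 <= x -> x < y -> y <= T ->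
  (forall t, t \in `]x, y[ -> w t = p t) -> forall t, t \in `[x, y] -> w t = p t.
Proof.
move=> cw cp x0 xy yT wp t txy; apply/eqP; rewrite -subr_eq0 -normr_le0.
apply/ler_addgt0Pl => eta eta0; rewrite addr0.
have cd : {within `[0, T], continuous (w \- p)}.
  have cp' : {within `[0, T], continuous p} by exact: continuous_subspaceT.
  by move=> s; apply: cvgB; [exact: cw|exact: cp'].
move: txy; rewrite in_itv/= => /andP[xt ty].
have [delta delta0 H] := within_cvg_near cd (le_trans x0 xt) (le_trans ty yT) eta0.
have [s [sx sy st]] : exists s, [/\ x < s, s < y & `|s - t| < delta].
  pose m := Num.min (delta / 2) ((y - x) / 2).
  have m0 : 0 < m by rewrite lt_min !divr_gt0// subr_gt0.
  have md : m <= delta / 2 by rewrite ge_min lexx.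
  have mx : m <= (y - x) / 2 by rewrite ge_min lexx orbT.
  have [tm|tm] := leP t ((x + y) / 2).
    exists (t + m / 2); split; try lra.
    by rewrite addrAC subrr add0r gtr0_norm; lra.
  exists (t - m / 2); split; try lra.
  by rewrite addrAC subrr add0r normrN gtr0_norm; lra.
have := H s (le_trans x0 (ltW sx)) (le_trans (ltW sy) yT) st.
by rewrite /= wp ?in_itv/= ?sx// subrr sub0r normrN.
Qed.

Lemma glue_vpoly m (c : nat -> 'I_m -> X) :
  (forall n, (n.+1 < N)%N ->
     vpoly (c n) (tau n.+1) = vpoly (c n.+1) (tau n.+1)) ->
  exists w, forall n, (n < N)%N ->
    forall t, t \in `[tau n, tau n.+1] -> w t = vpoly (c n) t.
Proof.
move=> cS; have [w [w0 wE]] := glue (fun n => vpoly (c n)) tauS.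
exists w => n nN t; rewrite in_itv/= => /andP[nt tn].
have [tE|tn'] := eqVneq t (tau n); last first.
  by apply: wE => //; rewrite in_itv/= tn andbT lt_neqAle eq_sym tn'.
rewrite tE; case: n nN {nt tn tE} => [//|n nN].
by rewrite (wE n (ltnW nN)) ?cS// in_itv/= lexx tauS// ltnW.
Qed.

Lemma pwpoly_closed_pieces (S : set X) m (w : R -> X) :
  pwpoly tau N S m w -> {within `[0, tau N], continuous w} ->
  exists c : nat -> 'I_m.+1 -> X, forall n, (n < N)%N -> (forall i, S (c n i)) /\
    forall t, t \in `[tau n, tau n.+1] -> w t = vpoly (c n) t.
Proof.
move=> pw cw; suff /choice[c cP] : forall n, exists c : 'I_m.+1 -> X, (n < N)%N ->
    (forall i, S (c i)) /\ forall t, t \in `[tau n, tau n.+1] -> w t = vpoly c t.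
  by exists c.
move=> n; have [nN|_] := ltnP n N; last by exists (fun=> 0).
have [c [Sc wc]] := pw n nN; exists c => _; split => // t.
apply: (within_eq_itvcc cw) => //; first exact: continuous_vpoly.
- by rewrite -tau0 (grid_le tauS)// ltnW.
- exact: tauS.
- exact: (grid_le tauS).
Qed.

Lemma grid_cover t : (0 < N)%N -> t \in `[0, tau N] ->
  exists2 n, (n < N)%N & t \in `[tau n, tau n.+1].
Proof.
rewrite in_itv/= => N0 /andP[t0 tN].
have ex : exists n, (0 < n)%N && (t <= tau n) by exists N; rewrite N0.
case: (ex_minnP ex) => -[//|n] /= tn nmin; exists n.
  by apply: nmin; rewrite N0.
rewrite in_itv/= tn andbT; case: n nmin {tn} => [_|n nmin]; first by rewrite tau0.
by rewrite leNgt; apply/negP => /ltW tn; have := nmin n.+1; rewrite tn ltnn => /(_ isT).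
Qed.

Lemma pieces_continuous m (w : R -> X) (c : nat -> 'I_m -> X) :
  (forall n, (n < N)%N -> forall t, t \in `[tau n, tau n.+1] -> w t = vpoly (c n) t) ->
  {within `[0, tau N], continuous w}.
Proof.
move=> wc; suff : forall n, (n <= N)%N -> {within `[0, tau n], continuous w}.
  exact.
elim=> [_|n IH nN]; first by rewrite tau0 set_itv1; exact: continuous_subspace1.
have -> : `[0, tau n.+1]%classic = `[0, tau n] `|` `[tau n, tau n.+1].
  rewrite (@itv_bndbnd_setU _ _ _ (BLeft (tau n))) ?bnd_simp; last 2 first.
  - by rewrite -tau0 (grid_le tauS)// ltnW.
  - by rewrite ltW// tauS.
  apply/seteqP; split=> t [] h; [|by right| |by right].
    left; move: h; rewrite /= !in_itv/=; lra.
  move: h; rewrite /= !in_itv/= => /andP[t0 tn].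
  have [tE|tn'] := eqVneq t (tau n).
    by right; rewrite /= ?in_itv/= tE lexx ltW// tauS.
  by left; rewrite /= ?in_itv/= t0 lt_neqAle tn'.
apply: withinU_continuous; [exact: itv_closed|exact: itv_closed|exact/IH/ltnW|].
apply: (@subspace_eq_continuous _ _ _ (vpoly (c n))).
  by move=> t /set_mem tn; apply/esym; exact: (wc n nN).
by apply: continuous_subspaceT; exact: continuous_vpoly.
Qed.

(** Integrating by parts on each time interval leaves boundary terms that
    telescope, by continuity of u, and vanish at 0 and tau N, where phi does. *)
Lemma weak_by_parts (u v phi : R -> R) (p : nat -> {poly R}) :
  (forall n, (n < N)%N -> forall t, t \in `[tau n, tau n.+1] -> u t = (p n).[t]) ->
  (forall n, (n < N)%N -> forall t, t \in `]tau n, tau n.+1[ -> v t = (p n)^`().[t]) ->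
  test_function (tau N) phi ->
  \int[mu]_(t in `]0, tau N[) (u t * derive1 phi t) =
  - \int[mu]_(t in `]0, tau N[) (v t * phi t).
Proof.
move=> up vp [dphi cdphi [x [y [x0 yT phixy]]]].
have phi0 : phi (tau 0%N) = 0.
  by apply: phixy; rewrite tau0 in_itv/= negb_and -!ltNge x0.
have phiN : phi (tau N) = 0.
  by apply: phixy; rewrite in_itv/= negb_and -!ltNge yT orbT.
have cphi : continuous phi.
  by move=> t; apply: differentiable_continuous; exact/derivable1_diffP.
have io (h : R -> R) n : continuous h -> mu.-integrable `]tau n, tau n.+1[ (EFin \o h).
  by move=> ch; apply: within_continuous_integrable; exact: continuous_subspaceT.
have c1 n : continuous (fun t => (p n).[t] * derive1 phi t).
  by move=> t; apply: cvgM; [exact: continuous_horner|exact: cdphi].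
have c2 n : continuous (fun t => (p n)^`().[t] * phi t).
  by move=> t; apply: cvgM; [exact: continuous_horner|exact: cphi].
have u1 n : (n < N)%N -> {in `]tau n, tau n.+1[, forall t,
    u t * derive1 phi t = (p n).[t] * derive1 phi t}.
  by move=> nN t tn; rewrite (up n)// (subset_itv_oo_cc tn).
have v1 n : (n < N)%N -> {in `]tau n, tau n.+1[, forall t,
    v t * phi t = (p n)^`().[t] * phi t}.
  by move=> nN t tn; rewrite (vp n).
have i1 n : (n < N)%N ->
    mu.-integrable `]tau n, tau n.+1[ (EFin \o (fun t => u t * derive1 phi t)).
  move=> nN; have := io _ n (c1 n).
  by apply: eq_integrable => // t /set_mem tn /=; rewrite (u1 n).
have i2 n : (n < N)%N ->
    mu.-integrable `]tau n, tau n.+1[ (EFin \o (fun t => v t * phi t)).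
  move=> nN; have := io _ n (c2 n).
  by apply: eq_integrable => // t /set_mem tn /=; rewrite (v1 n).
have piece n : (n < N)%N -> \int[mu]_(t in `]tau n, tau n.+1[) (u t * derive1 phi t) +
    \int[mu]_(t in `]tau n, tau n.+1[) (v t * phi t) =
    u (tau n.+1) * phi (tau n.+1) - u (tau n) * phi (tau n).
  move=> nN; rewrite -RintegralD//; [|exact: i1|exact: i2].
  have nn := tauS nN.
  rewrite (up n nN (tau n)) ?in_itv/= ?lexx ?(ltW nn)//.
  rewrite (up n nN (tau n.+1)) ?in_itv/= ?lexx ?(ltW nn)//.
  pose h t := (p n).[t] * derive1 phi t + (p n)^`().[t] * phi t.
  have ch : continuous h by move=> t; apply: cvgD; [exact: c1|exact: c2].
  transitivity (\int[mu]_(t in `]tau n, tau n.+1[) h t).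
    by apply: eq_Rintegral => t /set_mem tn; rewrite (u1 n)// (v1 n).
  rewrite -Rintegral_itvoo_itvcc; last exact: io.
  have dF (t : R) : is_derive t (1 : R) (fun t => (p n).[t] * phi t) (h t).
    have dp : is_derive t (1 : R) phi (derive1 phi t).
      by apply: DeriveDef; [exact: dphi|rewrite derive1E].
    have := is_deriveM (is_derive_poly (p n) t) dp.
    by rewrite /GRing.scale/= [phi t * _]mulrC.
  rewrite /Rintegral (continuous_FTC2 (F := fun t => (p n).[t] * phi t))//.
  - exact: continuous_subspaceT.
  - have cF : continuous (fun t => (p n).[t] * phi t).
      by move=> t; apply: cvgM; [exact: continuous_horner|exact: cphi].
    split=> [t _||]; first exact: (ex_derive (is_derive := dF t)).
    + exact/cvg_at_right_filter/cF.
    + exact/cvg_at_left_filter/cF.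
  - by move=> t _; rewrite derive1E (derive_val (is_derive := dF t)).
rewrite -[in LHS]tau0 -[in RHS]tau0 !(Rintegral_grid tauS)//.
apply/eqP; rewrite -subr_eq0 opprK -big_split /=.
under eq_bigr => n _ do rewrite piece//.
rewrite -(big_mkord xpredT
  (fun n => u (tau n.+1) * phi (tau n.+1) - u (tau n) * phi (tau n))).
by rewrite telescope_sumr// phi0 phiN !mulr0 subrr.
Qed.

Lemma continuous_pwpoly_H1 m (w w' : R -> X) (c : nat -> 'I_m.+2 -> X) :
  (forall n, (n < N)%N -> forall t, t \in `[tau n, tau n.+1] -> w t = vpoly (c n) t) ->
  (forall n, (n < N)%N -> forall t, t \in `]tau n, tau n.+1[ ->
     w' t = vpoly (dcoef (c n)) t) ->
  weak_derivative (tau N) w w' /\ H1 (tau N) w.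
Proof.
move=> wc w'c.
have pw : pwpoly tau N setT m.+1 w.
  move=> n nN; exists (c n); split => // t tn.
  by rewrite (wc n)// (subset_itv_oo_cc tn).
have pw' : pwpoly tau N setT m w'.
  by move=> n nN; exists (dcoef (c n)); split => // t /(w'c n nN).
have ww' : weak_derivative (tau N) w w'.
  split; first exact: (pwpoly_L2 tau0 tauS pw').
  move=> phi tphi x; have sx := hdot_scalarl x.
  apply: (weak_by_parts (p := fun n => lpoly (hdot^~ x) (c n))) => // n nN t tn.
    by rewrite horner_lpoly// (wc n).
  by rewrite -lpoly_dcoef// horner_lpoly// (w'c n).
split => //; split; last by exists w'.
  exact: pieces_continuous wc.
exact: (pwpoly_L2 tau0 tauS pw).
Qed.

Lemma pieces_H1 m (w : R -> X) (c : nat -> 'I_m.+2 -> X) :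
  (forall n, (n < N)%N -> forall t, t \in `[tau n, tau n.+1] -> w t = vpoly (c n) t) ->
  H1 (tau N) w.
Proof.
move=> wc; have [w' [_ w'c]] := glue (fun n => vpoly (dcoef (c n))) tauS.
apply: (continuous_pwpoly_H1 (w' := w') wc _).2 => n nN t tn.
apply: w'c => //; move: tn; rewrite !in_itv/= => /andP[-> /ltW ->] //.
Qed.

Lemma pint_Xn x y j : pint x y 'X^j = (y ^+ j.+1 - x ^+ j.+1) / j.+1%:R :> R.
Proof.
have -> : 'X^j = (j.+1%:R)^-1 *: ('X^(j.+1))^`() :> {poly R}.
  by rewrite derivXn -[X in _ *: X]scaler_nat scalerA mulVf ?scale1r// pnatr_eq0.
by rewrite linearZ /= pint_deriv !hornerXn mulrC.
Qed.

(** The function is the primitive of the projected weak derivative, restarted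
    from w at each node: the projection preserves the mean of the derivative over
    each time interval, that is, the increment of w, so the pieces match. *)
Lemma Pi1_set_nonempty m (w : R -> X) : H1 (tau N) w ->
  exists W, [/\ pwpoly tau N setT m.+1 W, H1 (tau N) W,
    weak_derivative (tau N) W (Pi0 tau N m (weak_deriv (tau N) w)) &
    forall n, (n < N)%N -> W (tau n) = w (tau n)].
Proof.
move=> [cw _ ex]; have [w'2 ww'] := xgetPex (fun=> 0) ex.
rewrite -/(weak_deriv (tau N) w) in w'2 ww'.
set w' := weak_deriv _ w in w'2 ww' *.
have /choice[d dE] : forall n, exists d : 'I_m.+1 -> X, (n < N)%N ->
    forall t, t \in `]tau n, tau n.+1[ -> Pi0 tau N m w' t = vpoly d t.
  move=> n; have [nN|_] := ltnP n N; last by exists (fun=> 0).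
  by have [d [_ dE]] := pwpoly_Pi0 tau m w' nN; exists d.
pose c n := startcoef (tau n) (w (tau n)) (fun i : 'I_m.+1 => i.+1%:R^-1 *: d n i).
have c0 n : vpoly (c n) (tau n) = w (tau n).
  by rewrite vpoly_startcoef big1 ?addr0// => j _; rewrite subrr scale0r.
have c1 n : (n < N)%N -> vpoly (c n) (tau n.+1) = w (tau n.+1).
  move=> nN; apply: hdot_inj => x; rewrite vpoly_startcoef hdotDl.
  have -> : hdot (w (tau n.+1)) x = hdot (w (tau n)) x +
      \int[mu]_(t in `]tau n, tau n.+1[) hdot (w' t) x.
    have cwx : {within `[0, tau N], continuous (fun t => hdot (w t) x)}.
      by move=> t; exact: (cvg_comp _ _ (cw t) (@continuous_hdot _ _ x (w t))).
    have iw' : mu.-integrable `]0, tau N[ (EFin \o (fun t => hdot (w' t) x)).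
      have := @L2_integrable_hdot _ _ _ w' x (cst 1) 1 `]0, tau N[%classic w'2.
      under [X in EFin \o X]eq_fun do rewrite mulr1.
      by apply => // t _; rewrite normr1.
    rewrite (weak_derivative_increment cwx iw')//; first by rewrite addrC subrK.
    - by move=> phi tphi; exact: ww'.
    - by rewrite -tau0 (grid_le tauS)// ltnW.
    - exact: tauS.
    - exact: (grid_le tauS).
  congr (_ + _).
  have := Pi0_moments tau0 tauS w'2 nN (dE n nN) x ord0.
  rewrite expr0 mulr1; under eq_Rintegral do rewrite expr0 mulr1.
  move=> ->; rewrite (scalar_sum _ _ (hdot_scalarl x)) linear_sum.
  apply: eq_bigr => j _; rewrite linearZ/= pint_Xn hdotZl.
  by ring.
have [W Wc] : exists W, forall n, (n < N)%N ->
    forall t, t \in `[tau n, tau n.+1] -> W t = vpoly (c n) t.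
  by apply: glue_vpoly => n nN; rewrite c1 ?c0// ltnW.
have W'c n : (n < N)%N -> forall t, t \in `]tau n, tau n.+1[ ->
    Pi0 tau N m w' t = vpoly (dcoef (c n)) t.
  move=> nN t tn; rewrite (dE n)//; apply: eq_bigr => j _; congr (_ *: _).
  by rewrite /dcoef /c /startcoef liftK scalerA divff ?scale1r// pnatr_eq0.
have [WW' HW] := continuous_pwpoly_H1 Wc W'c.
exists W; split => //.
  move=> n nN; exists (c n); split => // t tn.
  by rewrite (Wc n)// (subset_itv_oo_cc tn).
move=> n nN; rewrite (Wc n)// ?c0// in_itv/= lexx.
by rewrite ltW// tauS.
Qed.

Lemma Pi1P m (w : R -> X) : (0 < N)%N -> H1 (tau N) w ->
  [/\ pwpoly tau N setT m.+1 (Pi1 tau N m.+1 w),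
      {within `[0, tau N], continuous (Pi1 tau N m.+1 w)} &
      Pi1 tau N m.+1 w 0 = w 0].
Proof.
move=> N0 Hw.
have [pW [cW _ _] _ W0] := xgetPex (fun=> 0) (Pi1_set_nonempty m Hw).
by split => //; have := W0 0%N N0; rewrite tau0.
Qed.

End continuous_pieces.

(** * Finite dimensional variational problems *)

Section finite_dimension.
Context {R : realType} {X : hilbertType R}.
Implicit Types S : set X.

(** A generating family of minimal length is free. *)
Lemma fin_dim_basis S : fin_dim_subspace S -> exists d (e : 'I_d -> X),
  [/\ S = [set x | exists c : 'I_d -> R, x = \sum_i c i *: e i],
      forall i, S (e i) &
      forall c : 'I_d -> R, \sum_i c i *: e i = 0 -> forall i, c i = 0].
Proof.
move=> [n0 [e0 S0]].
pose spans n := `[< exists e : 'I_n -> X,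
  S = [set x | exists c : 'I_n -> R, x = \sum_i c i *: e i] >].
have [d /asboolP[e Se] dmin] : exists2 d, spans d & forall n, spans n -> (d <= n)%N.
  have ex : exists n, spans n by exists n0; apply/asboolP; exists e0.
  by case: (ex_minnP ex) => d sd dmin; exists d.
exists d, e; split => // [i|c ce j].
  rewrite Se; exists (fun j => (j == i)%:R).
  by rewrite (bigD1 i)//= eqxx scale1r big1 ?addr0// => j /negbTE->; rewrite scale0r.
apply/eqP/negPn/negP => cj.
case: d j e c Se ce cj dmin => [[]//|d] j e c Se ce cj dmin.
suff : spans d by move/dmin; rewrite ltnn.
apply/asboolP; exists (fun i => e (lift j i)); rewrite Se.
have ej : e j = \sum_i (- (c (lift j i) / c j)) *: e (lift j i).
  apply: (scalerI cj); move: ce; rewrite (bigD1_ord j)//= => /eqP.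
  rewrite addr_eq0 => /eqP ->; rewrite scaler_sumr -sumrN.
  apply: eq_bigr => i _; rewrite scalerA mulrN mulrCA divff// mulr1.
  by rewrite scaleNr.
apply/seteqP; split=> x [s ->].
  exists (fun i => s (lift j i) - s j * (c (lift j i) / c j)).
  rewrite (bigD1_ord j)//= ej scaler_sumr -big_split/=.
  by apply: eq_bigr => i _; rewrite scalerA mulrN -scalerDl addrC.
exists (fun i => if unlift j i is Some i' then s i' else 0).
rewrite (bigD1_ord j)//= unlift_none scale0r add0r.
by apply: eq_bigr => i _; rewrite liftK.
Qed.

Lemma fin_dim_sum S (I : finType) (s : I -> R) (x : I -> X) :
  fin_dim_subspace S -> (forall i, S (x i)) -> S (\sum_i s i *: x i).
Proof.
move=> [n [e ->]] /choice[c xE].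
exists (fun l => \sum_i s i * c i l).
under eq_bigr => i _ do rewrite xE scaler_sumr.
rewrite exchange_big; apply: eq_bigr => l _ /=.
by rewrite scaler_suml; apply: eq_bigr => i _; rewrite scalerA.
Qed.

Lemma fin_dimZ S a x : fin_dim_subspace S -> S x -> S (a *: x).
Proof.
move=> fS Sx; have := @fin_dim_sum S 'I_1 (fun=> a) (fun=> x) fS.
by rewrite big_ord1; apply.
Qed.

Lemma fin_dimD S x y : fin_dim_subspace S -> S x -> S y -> S (x + y).
Proof.
move=> fS Sx Sy.
have := @fin_dim_sum S bool (fun=> 1) (fun i => if i then x else y) fS.
by rewrite big_bool !scale1r; apply => -[].
Qed.

Lemma fin_dimB S x y : fin_dim_subspace S -> S x -> S y -> S (x - y).
Proof.
by move=> fS Sx Sy; rewrite -scaleN1r; apply: fin_dimD => //; exact: fin_dimZ.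
Qed.

Lemma fin_dim_vpoly S n (c : 'I_n -> X) t :
  fin_dim_subspace S -> (forall i, S (c i)) -> S (vpoly c t).
Proof. by move=> fS Sc; exact: fin_dim_sum. Qed.

End finite_dimension.

(** Existence from uniqueness. The index type is arbitrary because it will be
    a product of polynomial degrees and basis vectors. *)
Lemma square_system {F : fieldType} (I : finType) (M : I -> I -> F) :
  (forall x : I -> F, (forall j, \sum_i x i * M i j = 0) -> forall i, x i = 0) ->
  forall y : I -> F, exists x, forall j, \sum_i x i * M i j = y j.
Proof.
move=> Mx y; pose A : 'M[F]_(#|I|) := \matrix_(i, j) M (enum_val i) (enum_val j).
have sumE (x : 'rV[F]_(#|I|)) j :
    \sum_i x 0 (enum_rank i) * M i j = (x *m A) 0 (enum_rank j).
  rewrite mxE (reindex_onto enum_val enum_rank)/=; last by move=> i _; rewrite enum_rankK.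
  apply: eq_big => [i|i _]; first by rewrite enum_valK eqxx.
  by rewrite enum_valK mxE enum_rankK.
have uA : A \in unitmx.
  apply: unitmx_row_ker => x xA; apply/rowP => i; rewrite mxE -(enum_valK i).
  by apply: (Mx (fun i => x 0 (enum_rank i))) => j; rewrite sumE xA mxE.
pose x := (\row_i y (enum_val i)) *m invmx A.
by exists (fun i => x 0 (enum_rank i)) => j; rewrite sumE mulmxKV// mxE enum_rankK.
Qed.

Section bilinear_form_polynomials.
Context {R : realType} {X Y : hilbertType R}.
Variable c : X -> Y -> R.
Hypotheses (cl : forall y, scalar (c^~ y)) (cr : forall x, scalar (c x)).

(** The polynomial t |-> c (x t) (y t), for x and y given by coefficients on two
    families of polynomials. *)
Definition bpoly (I J : finType) (phi : I -> {poly R}) (x : I -> X)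
    (psi : J -> {poly R}) (y : J -> Y) : {poly R} :=
  \sum_j \sum_i c (x i) (y j) *: (phi i * psi j).

Lemma horner_bpoly (I J : finType) (phi : I -> {poly R}) x (psi : J -> {poly R}) y t :
  (bpoly phi x psi y).[t] =
  c (\sum_i (phi i).[t] *: x i) (\sum_j (psi j).[t] *: y j).
Proof.
rewrite (scalar_sum _ _ (cr _)) horner_sum; apply: eq_bigr => j _.
rewrite (scalar_sum _ _ (cl _)) horner_sum mulr_sumr; apply: eq_bigr => i _.
by rewrite hornerZ hornerM; ring.
Qed.

Lemma bpolyE (I J : finType) (phi : I -> {poly R}) x (psi : J -> {poly R}) y :
  bpoly phi x psi y = \sum_j (\sum_i c (x i) (y j) *: phi i) * psi j.
Proof.
apply: eq_bigr => j _; rewrite mulr_suml.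
by apply: eq_bigr => i _; rewrite scalerAl.
Qed.

End bilinear_form_polynomials.

Lemma deriv_bpoly {R : realType} {X : hilbertType R} (c : X -> X -> R) (I : finType)
    (phi : I -> {poly R}) (x : I -> X) : (forall u v, c u v = c v u) ->
  (bpoly c phi x phi x)^`() = bpoly c phi x (fun i => (phi i)^`()) x *+ 2.
Proof.
move=> c_sym; pose dphi i := (phi i)^`(); rewrite -/dphi.
have sym : bpoly c phi x dphi x = \sum_j \sum_i c (x i) (x j) *: (dphi i * phi j).
  rewrite /bpoly exchange_big; apply: eq_bigr => j _; apply: eq_bigr => i _ /=.
  by rewrite c_sym mulrC.
rewrite mulr2n {1}sym /bpoly -big_split linear_sum/=; apply: eq_bigr => j _.
rewrite -big_split linear_sum/=; apply: eq_bigr => i _.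
by rewrite linearZ/= derivM scalerDr.
Qed.

Section elliptic.
Context {R : realType} {X : hilbertType R}.
Variables (a : X -> X -> R) (S : set X).
Hypotheses (al : forall y, scalar (a^~ y)) (ar : forall x, scalar (a x)).
Hypotheses (a_elliptic : form_elliptic a) (S_fin : fin_dim_subspace S).

Lemma elliptic_ge0 x : 0 <= a x x.
Proof.
have [c [c0 H]] := a_elliptic; apply: le_trans (H x).
by rewrite mulr_ge0 ?sqr_ge0// ltW.
Qed.

Lemma elliptic_eq0 x : a x x = 0 -> x = 0.
Proof.
have [c [c0 H]] := a_elliptic => ax; have := H x; rewrite ax pmulr_rle0// => x0.
by apply/eqP; rewrite -normr_eq0 -sqrf_eq0 eq_le x0 sqr_ge0.
Qed.

Definition galerkin (l : X -> R) : X :=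
  xget 0 [set u | S u /\ forall v, S v -> a u v = l v].

Lemma galerkin_unique u v : S u -> S v ->
  (forall w, S w -> a u w = a v w) -> u = v.
Proof.
move=> Su Sv uv; apply/eqP; rewrite -subr_eq0; apply/eqP/elliptic_eq0.
have Suv : S (u - v) by exact: fin_dimB.
have := al (u - v) (-1) v u; rewrite scaleN1r [- v + u]addrC => ->.
by rewrite uv//; lra.
Qed.

Lemma galerkinP l : scalar l ->
  S (galerkin l) /\ forall v, S v -> a (galerkin l) v = l v.
Proof.
move=> ll; apply: (@xgetPex _ 0 [set u | S u /\ forall v, S v -> a u v = l v]).
have [d [e [Se Sei ind]]] := fin_dim_basis S_fin.
have [x0 x0j i|x xE] := square_system (M := fun i j => a (e i) (e j)) _ (fun j => l (e j)).
  apply: ind; apply: elliptic_eq0; rewrite (scalar_sum _ _ (ar _)) big1// => j _.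
  by rewrite (scalar_sum _ _ (al _)) x0j mulr0.
exists (\sum_i x i *: e i); split; first exact: fin_dim_sum.
move=> v; rewrite {1}Se => -[y ->].
rewrite (scalar_sum _ _ (ar _)) scalar_sum//; apply: eq_bigr => j _.
by rewrite (scalar_sum _ _ (al _)) xE.
Qed.

Lemma galerkin_eq u l : scalar l -> S u -> (forall v, S v -> a u v = l v) ->
  u = galerkin l.
Proof.
move=> ll Su ul; have [Sg gl] := galerkinP ll.
by apply: galerkin_unique => // v Sv; rewrite ul// gl.
Qed.

End elliptic.

Lemma galerkin_sum {R : realType} {X : hilbertType R} (a : X -> X -> R) (S : set X)
    (I : finType) (s : I -> R) (l : X -> R) (li : I -> X -> R) :
  (forall y, scalar (a^~ y)) -> (forall x, scalar (a x)) -> form_elliptic a ->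
  fin_dim_subspace S -> (forall i, scalar (li i)) -> scalar l ->
  (forall v, l v = \sum_i s i * li i v) ->
  galerkin a S l = \sum_i s i *: galerkin a S (li i).
Proof.
move=> al ar ae Sf li_s l_s lE.
have gP i := galerkinP al ar ae Sf (li_s i).
apply/esym/galerkin_eq => //.
  by apply: fin_dim_sum => // i; case: (gP i).
move=> v Sv; rewrite (scalar_sum _ _ (al _)) lE; apply: eq_bigr => i _.
by case: (gP i) => _ ->.
Qed.

(** * The pressure problem on one time interval *)

Section petrov_galerkin_step.
Context {R : realType} {Y : hilbertType R}.
Variables (S : set Y) (c k : Y -> Y -> R) (x y : R) (m : nat).
Hypothesis S_fin : fin_dim_subspace S.
Hypotheses (cl : forall z, scalar (c^~ z)) (cr : forall z, scalar (c z)).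
Hypotheses (kl : forall z, scalar (k^~ z)) (kr : forall z, scalar (k z)).
Hypothesis c_ge0 : forall p, 0 <= c p p.
Hypothesis c_eq0 : forall p, S p -> c p p = 0 -> p = 0.
Hypothesis k_sym : forall p z, k p z = k z p.
Hypothesis k_ge0 : forall p, 0 <= k p p.
Hypothesis xy : x < y.

(** A basis of the polynomials of degree at most m + 1 vanishing at the left end
    of the interval, whose derivatives are multiples of the monomials. *)
Definition trial (i : nat) : {poly R} := 'X^(i.+1) - (x ^+ i.+1)%:P.

Lemma deriv_trial i : (trial i)^`() = 'X^i *+ i.+1.
Proof. by rewrite linearB/= derivC subr0 derivXn. Qed.

Lemma horner_trial i t : (trial i).[t] = t ^+ i.+1 - x ^+ i.+1.
Proof. by rewrite !hornerE. Qed.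

(** The weak form of c(P', z) + k(P, z) tested with t^j, for the pressure
    P(t) = \sum_i (t^(i+1) - x^(i+1)) p_i. *)
Definition step_form (p : 'I_m.+1 -> Y) (j : 'I_m.+1) (z : Y) : R :=
  \sum_i (c (p i) z * pint x y ((trial i)^`() * 'X^j) +
          k (p i) z * pint x y (trial i * 'X^j)).

(** Testing with P' gives the integral of c(P', P') plus k(P(y), P(y)) / 2, since
    P(x) = 0; both terms are nonnegative, so P' = 0. *)
Lemma step_form_eq0 (p : 'I_m.+1 -> Y) : (forall i, S (p i)) ->
  (forall j z, S z -> step_form p j z = 0) -> forall i, p i = 0.
Proof.
move=> Sp p0.
pose phi (i : 'I_m.+1) := trial i; pose dphi (i : 'I_m.+1) := (trial i)^`().
have sum0 : pint x y (bpoly c dphi p dphi p) + pint x y (bpoly k phi p dphi p) = 0.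
  rewrite !linear_sum -big_split big1//= => j _.
  rewrite !linear_sum -big_split/=.
  transitivity (j.+1%:R * step_form p j (p j)); last by rewrite p0// mulr0.
  rewrite /step_form mulr_sumr.
  apply: eq_bigr => i _; rewrite !linearZ/= [dphi j]deriv_trial.
  rewrite !mulrnAr !linearMn/= -![pint _ _ _ *+ _]mulr_natr; ring.
have k0 : 0 <= pint x y (bpoly k phi p dphi p).
  have kE : (bpoly k phi p phi p)^`() = bpoly k phi p dphi p *+ 2.
    exact: deriv_bpoly.
  have := pint_deriv x y (bpoly k phi p phi p).
  have phi0 : \sum_i (phi i).[x] *: p i = 0.
    by apply: big1 => i _; rewrite horner_trial subrr scale0r.
  have k00 : k 0 0 = 0 by have := kl 0 1 0 0; rewrite scaler0 addr0; lra.
  rewrite kE linearMn/= !horner_bpoly// phi0 k00 subr0 => kP.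
  by rewrite -(pmulrn_lge0 _ (isT : 0 < 2)%N) kP.
have c0 : 0 <= pint x y (bpoly c dphi p dphi p).
  by apply: pint_ge0 (ltW xy) _ => t _; rewrite horner_bpoly.
have /(pint_eq0 xy) bc0 : pint x y (bpoly c dphi p dphi p) = 0 by lra.
have {}bc0 : bpoly c dphi p dphi p = 0.
  by apply: bc0 => t _; rewrite horner_bpoly.
have P0 t : vpoly (fun i : 'I_m.+1 => i.+1%:R *: p i) t = 0.
  apply: c_eq0.
    by apply: fin_dim_vpoly => // i; exact: fin_dimZ.
  have := horner_bpoly cl cr dphi p dphi p t; rewrite bc0 horner0.
  have -> : \sum_i (dphi i).[t] *: p i = vpoly (fun i : 'I_m.+1 => i.+1%:R *: p i) t.
    apply: eq_bigr => i _.
    by rewrite /dphi deriv_trial hornerMn hornerXn scalerA mulr_natr.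
  by [].
move=> i; have /(_ i)/eqP : (fun i : 'I_m.+1 => i.+1%:R *: p i) =1 (fun=> 0).
  apply: (vpoly_inj xy) => t _; rewrite P0.
  by rewrite /vpoly big1// => j _; rewrite scaler0.
by rewrite scaler_eq0 pnatr_eq0 => /eqP.
Qed.

(** There are as many test functions t^j z as trial functions, so existence
    follows from [step_form_eq0]. *)
Lemma step_form_exists (l : 'I_m.+1 -> Y -> R) : (forall j, scalar (l j)) ->
  exists p : 'I_m.+1 -> Y, (forall i, S (p i)) /\
    forall j z, S z -> step_form p j z = l j z.
Proof.
move=> ll; have [d [e [Se Sei ind]]] := fin_dim_basis S_fin.
pose M (u v : 'I_m.+1 * 'I_d) :=
  c (e u.2) (e v.2) * pint x y ((trial u.1)^`() * 'X^(v.1)) +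
  k (e u.2) (e v.2) * pint x y (trial u.1 * 'X^(v.1)).
pose p (s : 'I_m.+1 * 'I_d -> R) i := \sum_n s (i, n) *: e n.
have Sp s i : S (p s i) by exact: fin_dim_sum.
have ME s v : \sum_u s u * M u v = step_form (p s) v.1 (e v.2).
  rewrite /step_form.
  transitivity (\sum_i \sum_n s (i, n) * M (i, n) v).
    by rewrite pair_bigA; apply: eq_bigr => -[].
  apply: eq_bigr => i _.
  rewrite (scalar_sum _ _ (cl _)) (scalar_sum _ _ (kl _)) !mulr_suml -big_split.
  by apply: eq_bigr => n _ /=; rewrite /M /=; ring.
have form_scalar q j : scalar (step_form q j).
  move=> a u v; rewrite /step_form mulr_sumr -big_split; apply: eq_bigr => i _ /=.
  by rewrite cr kr; ring.
have [s s0 [i n]|s sE] := square_system (M := M) _ (fun v => l v.1 (e v.2)).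
  have p0 : forall i, p s i = 0.
    apply: step_form_eq0 => // j z; rewrite {1}Se => -[r ->].
    rewrite scalar_sum//; apply: big1 => n' _.
    by have := s0 (j, n'); rewrite ME /= => ->; rewrite mulr0.
  exact: ind (p0 i) n.
exists (p s); split=> // j z; rewrite {1}Se => -[r ->].
rewrite !scalar_sum//; apply: eq_bigr => n _.
by rewrite -(ME s (j, n)) sE.
Qed.

End petrov_galerkin_step.

(** * Elimination of the displacement *)

Section one_step.
Context {R : realType} {V Q Q0 : hilbertType R}.
Variables (emb : {linear Q -> Q0}) (a : {biscalar V}) (k : {biscalar Q}).
Variable (b : {bilinear V -> Q0 -> R | *%R & *%R}).
Variables (Vh : set V) (Qh : set Q) (tau : nat -> R) (N m : nat).
Hypotheses (a_ell : form_elliptic a) (k_bnd : form_bounded k).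
Hypotheses (Vh_fin : fin_dim_subspace Vh) (Qh_fin : fin_dim_subspace Qh).
Hypothesis tau0 : tau 0%N = 0.
Hypothesis tauS : forall n, (n < N)%N -> tau n < tau n.+1.
Notation mu := (@lebesgue_measure R).

Let al := bilinear_scalarl a.
Let ar := bilinear_scalarr a.

(** The discrete displacement caused by a load, and the one caused by a
    pressure. *)
Definition load_disp (F : dual V) : V := galerkin a Vh F.
Definition pressure_disp (p : Q) : V := galerkin a Vh (fun v => b v (emb p)).

(** The Schur complement of the displacement block. *)
Definition schur (p z : Q) : R := b (pressure_disp p) (emb z).

Let b_scalar p : scalar (fun v => b v (emb p)).
Proof. exact: bilinear_scalarl. Qed.

Lemma load_dispP F : Vh (load_disp F) /\
  forall v, Vh v -> a (load_disp F) v = F v.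
Proof. by apply: galerkinP => //; exact: dual_scalar. Qed.

Lemma pressure_dispP p : Vh (pressure_disp p) /\
  forall v, Vh v -> a (pressure_disp p) v = b v (emb p).
Proof. exact: galerkinP. Qed.

Lemma load_disp_vpoly n (F : 'I_n -> dual V) t :
  load_disp (vpoly F t) = vpoly (fun i => load_disp (F i)) t.
Proof.
apply: galerkin_sum => //; [by move=> i; exact: dual_scalar|exact: dual_scalar|].
by move=> v; rewrite (scalar_sum _ _ (dual_eval_scalar v)).
Qed.

Lemma pressure_disp_sum (I : finType) (s : I -> R) (p : I -> Q) :
  pressure_disp (\sum_i s i *: p i) = \sum_i s i *: pressure_disp (p i).
Proof.
apply: galerkin_sum => // v; rewrite linear_sum linear_sumr.
by apply: eq_bigr => i _; rewrite linearZ /= linearZr.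
Qed.

Lemma pressure_dispD p p' s :
  pressure_disp (s *: p + p') = s *: pressure_disp p + pressure_disp p'.
Proof.
have := pressure_disp_sum (fun i : bool => if i then s else 1)
  (fun i => if i then p else p').
by rewrite !big_bool !scale1r.
Qed.

Lemma schur_scalarl z : scalar (schur^~ z).
Proof. by move=> s p p'; rewrite /schur pressure_dispD linearPl. Qed.

Lemma schur_scalarr p : scalar (schur p).
Proof. by move=> s z z'; rewrite /schur linearP linearPr. Qed.

Lemma schurE p : schur p p = a (pressure_disp p) (pressure_disp p).
Proof. by have [Vp ->] := pressure_dispP p. Qed.

Lemma schur_ge0 p : 0 <= schur p p.
Proof. by rewrite schurE; exact: elliptic_ge0. Qed.

Lemma riesz_form z : exists r, forall p, k p z = hdot p r.
Proof.
have [C kC] := k_bnd.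
have bk : exists M, forall p, `|k p z| <= M * `|p|.
  by exists (C * `|z|) => p; rewrite mulrAC.
have [r rE] := riesz_exists (Dual (bilinear_scalarl k z) bk).
by exists r => p; rewrite hdotC -rE.
Qed.

(** The projection is orthogonal for the inner product of Q, yet it preserves
    moments taken with the bounded form k, as k(., z) is an inner product by a
    fixed vector. *)
Lemma Pi0_form_moments P n (pc : 'I_m.+2 -> Q) (pi : 'I_m.+1 -> Q) :
  L2 (tau N) P -> (n < N)%N ->
  (forall t, t \in `]tau n, tau n.+1[ -> P t = vpoly pc t) ->
  (forall t, t \in `]tau n, tau n.+1[ -> Pi0 tau N m P t = vpoly pi t) ->
  forall z (j : 'I_m.+1),
  pint (tau n) (tau n.+1) (lpoly (k^~ z) pi * 'X^j) =
  pint (tau n) (tau n.+1) (lpoly (k^~ z) pc * 'X^j).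
Proof.
move=> P2 nN Pc Ppi z j; have [r rE] := riesz_form z.
have kE i (c : 'I_i -> Q) : lpoly (k^~ z) c = lpoly (hdot^~ r) c.
  by apply: eq_bigr => l _; rewrite rE.
rewrite !kE -(Pi0_moments tau0 tauS P2 nN Ppi) -Rintegral_horner; last exact: tauS.
apply: eq_Rintegral => t /set_mem tn.
by rewrite hornerM hornerXn horner_lpoly ?Pc//; exact: hdot_scalarl.
Qed.

(** Moments of the right-hand side of the pressure equation, after elimination
    of the displacement. *)
Definition pressure_load n (F : 'I_m.+2 -> dual V) (G : 'I_m.+1 -> dual Q) (p0 : Q)
    (j : 'I_m.+1) (z : Q) : R :=
  pint (tau n) (tau n.+1) (lpoly (fun l : dual Q => l z) G * 'X^j) -
  \sum_(i < m.+1) b (load_disp (F (lift ord0 i))) (emb z) *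
     pint (tau n) (tau n.+1) ((trial (tau n) i)^`() * 'X^j) -
  k p0 z * pint (tau n) (tau n.+1) 'X^j.

Lemma pressure_load_scalar n F G p0 j : scalar (pressure_load n F G p0 j).
Proof.
move=> s u v; rewrite /pressure_load.
have -> : lpoly (fun l : dual Q => l (s *: u + v)) G =
    s *: lpoly (fun l : dual Q => l u) G + lpoly (fun l : dual Q => l v) G.
  rewrite /lpoly scaler_sumr -big_split; apply: eq_bigr => i _.
  by rewrite dualD dualZ scalerDl scalerA.
have -> : \sum_(i < m.+1) b (load_disp (F (lift ord0 i))) (emb (s *: u + v)) *
     pint (tau n) (tau n.+1) ((trial (tau n) i)^`() * 'X^j) =
   s * (\sum_(i < m.+1) b (load_disp (F (lift ord0 i))) (emb u) *
     pint (tau n) (tau n.+1) ((trial (tau n) i)^`() * 'X^j)) +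
   \sum_(i < m.+1) b (load_disp (F (lift ord0 i))) (emb v) *
     pint (tau n) (tau n.+1) ((trial (tau n) i)^`() * 'X^j).
  rewrite mulr_sumr -big_split; apply: eq_bigr => i _.
  by rewrite linearP linearPr /=; ring.
by rewrite (bilinear_scalarr k p0) mulrDl -scalerAl (pint_scalar (tau n)); ring.
Qed.

(** Both sides of the pressure equation are polynomials of degree at most m in
    time, so nothing is lost by testing with t^j for j <= m; the projection of the
    pressure has the same moments against these as the pressure itself. *)
Lemma pressure_equation_weak P U (f1 : R -> dual V) (g0 : R -> dual Q) n
    (pc : 'I_m.+2 -> Q) (F : 'I_m.+2 -> dual V) (G : 'I_m.+1 -> dual Q) z :
  L2 (tau N) P -> (n < N)%N ->
  (forall t, t \in `]tau n, tau n.+1[ -> P t = vpoly pc t) ->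
  (forall t, t \in `]tau n, tau n.+1[ -> U t = load_disp (f1 t) + pressure_disp (P t)) ->
  (forall t, t \in `]tau n, tau n.+1[ -> f1 t = vpoly F t) ->
  (forall t, t \in `]tau n, tau n.+1[ -> g0 t = vpoly G t) ->
  (forall t, t \in `]tau n, tau n.+1[ ->
     b (derive1 U t) (emb z) + k (Pi0 tau N m P t) z = g0 t z) <->
  (forall j, step_form schur k (tau n) (tau n.+1) (fun i => pc (lift ord0 i)) j z =
     pressure_load n F G (vpoly pc (tau n)) j z).
Proof.
move=> P2 nN Pc UE f1F g0G.
have xy := tauS nN; set x := tau n in xy *; set y := tau n.+1 in xy *.
pose uc i := load_disp (F i) + pressure_disp (pc i).
have Uc t : t \in `]x, y[ -> U t = vpoly uc t.
  move=> tn; rewrite UE// f1F// Pc// load_disp_vpoly pressure_disp_sum.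
  by rewrite vpolyD.
have dU t : t \in `]x, y[ -> derive1 U t = vpoly (dcoef uc) t.
  exact: derive1_eq_vpoly.
have [pi [_ Ppi]] := pwpoly_Pi0 tau m P nN.
pose pB := lpoly (fun u => b u (emb z)) (dcoef uc).
pose pk := lpoly (k^~ z) pi.
pose pg := lpoly (fun l : dual Q => l z) G.
have pE t : t \in `]x, y[ ->
    (b (derive1 U t) (emb z) + k (Pi0 tau N m P t) z = g0 t z) =
    ((pB + pk).[t] = pg.[t]).
  move=> tn; rewrite hornerD !horner_lpoly//; last exact: bilinear_scalarl.
  by rewrite dU// g0G// Ppi.
have pBE (j : 'I_m.+1) : pint x y (pB * 'X^j) = \sum_(i < m.+1)
    (b (load_disp (F (lift ord0 i))) (emb z) + schur (pc (lift ord0 i)) z) *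
    pint x y ((trial x i)^`() * 'X^j).
  rewrite /pB /lpoly mulr_suml linear_sum; apply: eq_bigr => i _.
  rewrite deriv_trial -scalerAl linearZ/= /dcoef /uc linearZl_LR linearDl/=.
  by rewrite mulrnAl linearMn/= -[pint _ _ _ *+ _]mulr_natr; ring.
have pkE (j : 'I_m.+1) : pint x y (pk * 'X^j) =
    k (vpoly pc x) z * pint x y 'X^j +
    \sum_(i < m.+1) k (pc (lift ord0 i)) z * pint x y (trial x i * 'X^j).
  rewrite (Pi0_form_moments P2 nN Pc Ppi).
  have -> : lpoly (k^~ z) pc = (k (vpoly pc x) z)%:P +
      \sum_(i < m.+1) k (pc (lift ord0 i)) z *: trial x i.
    apply: (poly_eq_itv xy) => t _; rewrite horner_lpoly; last exact: bilinear_scalarl.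
    rewrite hornerD hornerC horner_sum (vpoly_startE x) linearDl/=.
    congr (_ + _); rewrite (scalar_sum _ _ (bilinear_scalarl k z)).
    by apply: eq_bigr => i _; rewrite hornerZ horner_trial mulrC.
  rewrite mulrDl mul_polyC linearD/= linearZ/= mulr_suml linear_sum; congr (_ + _).
  by apply: eq_bigr => i _; rewrite -scalerAl linearZ.
have stepE (j : 'I_m.+1) : pint x y ((pB + pk - pg) * 'X^j) =
    step_form schur k x y (fun i => pc (lift ord0 i)) j z -
    pressure_load n F G (vpoly pc x) j z.
  rewrite mulrBl mulrDl linearB linearD/= pBE pkE /pressure_load /step_form -/x -/y -/pg.
  rewrite big_split/=.
  under eq_bigr do rewrite mulrDl.
  by rewrite big_split/=; ring.
split=> [eqs j|eqs t tn].
  have e : pB + pk = pg by apply: (poly_eq_itv xy) => t tn; rewrite -pE// eqs.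
  by apply/eqP; rewrite -subr_eq0 -stepE e subrr mul0r linear0.
rewrite pE//; congr (_.[t]); apply/eqP; rewrite -subr_eq0; apply/eqP.
apply: (pint_orth (n := m.+1) xy) => [|j]; last by rewrite stepE eqs subrr.
rewrite (leq_trans (size_polyD _ _))// geq_max size_polyN !size_lpoly andbT.
by rewrite (leq_trans (size_polyD _ _))// geq_max !size_lpoly.
Qed.

End one_step.

(** * Solvability and energy identity *)

Section fully_discrete_scheme.
Context {R : realType} {V Q Q0 : hilbertType R}.
Variables (emb : {linear Q -> Q0}) (a : {biscalar V}) (k : {biscalar Q}).
Variable (b : {bilinear V -> Q0 -> R | *%R & *%R}).
Variables (Vh : set V) (Qh : set Q) (tau : nat -> R) (N m : nat).
Variables (f : R -> dual V) (g : R -> dual Q) (uh0 : V) (ph0 : Q).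
Hypotheses (a_ell : form_elliptic a) (a_sym : form_symmetric a).
Hypotheses (k_bnd : form_bounded k) (k_ell : form_elliptic k).
Hypothesis (k_sym : form_symmetric k).
Hypotheses (Vh_fin : fin_dim_subspace Vh) (Qh_fin : fin_dim_subspace Qh).
Hypothesis b_inj : forall p, Qh p -> (forall v, Vh v -> b v (emb p) = 0) -> p = 0.
Hypothesis tau0 : tau 0%N = 0.
Hypothesis tauS : forall n, (n < N)%N -> tau n < tau n.+1.
Hypotheses (N_gt0 : (0 < N)%N) (fH1 : H1 (tau N) f).
Hypotheses (uh0_in : Vh uh0) (ph0_in : Qh ph0).
Hypothesis init : forall v, Vh v -> a uh0 v - b v (emb ph0) = f 0 v.
Notation mu := (@lebesgue_measure R).

Notation sol := (discrete_solution a k b emb Vh Qh tau N m.+1 f g uh0 ph0).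
Notation f1 := (Pi1 tau N m.+1 f).
Notation g0 := (Pi0 tau N m g).
Notation A := (load_disp a Vh).
Notation D := (pressure_disp emb a b Vh).
Notation c := (schur emb a b Vh).
Notation weak_eq F G n p p0 := (forall j z, Qh z ->
  step_form c k (tau n) (tau n.+1) p j z =
  pressure_load emb a k b Vh tau (m := m) n F G p0 j z).

(** c(p, p) is the energy of the displacement D p; if it vanishes, so does
    b(., emb p) on Vh, and the inf-sup condition, in the form [b_inj], applies. *)
Lemma schur_eq0 p : Qh p -> c p p = 0 -> p = 0.
Proof.
move=> Qp; rewrite schurE// => /(elliptic_eq0 a_ell) Dp; apply: b_inj => // v Vv.
by have [_ <-//] := pressure_dispP emb b a_ell Vh_fin p; rewrite Dp linear0l.
Qed.

Lemma dispP (F : dual V) p : Vh (A F + D p) /\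
  forall v, Vh v -> a (A F + D p) v - b v (emb p) = F v.
Proof.
have [VA AE] := load_dispP a_ell Vh_fin F.
have [VD DE] := pressure_dispP emb b a_ell Vh_fin p.
split=> [|v Vv]; first exact: fin_dimD.
by rewrite linearDl /= AE// DE// addrK.
Qed.

Lemma disp_unique (F : dual V) p u : Vh u ->
  (forall v, Vh v -> a u v - b v (emb p) = F v) -> u = A F + D p.
Proof.
move=> Vu uE; have [VAD ADE] := dispP F p.
apply: (galerkin_unique (bilinear_scalarl a) a_ell Vh_fin) => // v Vv.
by apply: (addIr (- b v (emb p))); rewrite uE// ADE.
Qed.

Lemma data_coefficients : exists (F : nat -> 'I_m.+2 -> dual V)
    (G : nat -> 'I_m.+1 -> dual Q), forall n, (n < N)%N ->
  (forall t, t \in `[tau n, tau n.+1] -> f1 t = vpoly (F n) t) /\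
  (forall t, t \in `]tau n, tau n.+1[ -> g0 t = vpoly (G n) t).
Proof.
have [pf cf _] := Pi1P tau0 tauS m N_gt0 fH1.
have [F FE] := pwpoly_closed_pieces tau0 tauS pf cf.
have /choice[G GE] : forall n, exists G : 'I_m.+1 -> dual Q, (n < N)%N ->
    forall t, t \in `]tau n, tau n.+1[ -> g0 t = vpoly G t.
  move=> n; have [nN|_] := ltnP n N; last by exists (fun=> 0).
  by have [G [_ GE]] := pwpoly_Pi0 tau m g nN; exists G.
by exists F, G => n nN; split; [case: (FE n nN)|exact: GE].
Qed.

Lemma Pi1_initial : f1 0 = f 0.
Proof. by have [] := Pi1P tau0 tauS m N_gt0 fH1. Qed.

(** Compatible initial values extend the displacement equation to t = 0. *)
Lemma initial_disp : uh0 = A (f1 0) + D ph0.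
Proof. by apply: disp_unique => // v Vv; rewrite Pi1_initial init. Qed.

Section data.
Let cl := schur_scalarl emb b a_ell Vh_fin.
Let cr := schur_scalarr emb a b Vh.
Let kl := bilinear_scalarl k.
Let kr := bilinear_scalarr k.
Let c_ge0 := schur_ge0 emb b a_ell Vh_fin.
Let k_ge0 := elliptic_ge0 k_ell.
Variables (F : nat -> 'I_m.+2 -> dual V) (G : nat -> 'I_m.+1 -> dual Q).
Hypothesis FG : forall n, (n < N)%N ->
  (forall t, t \in `[tau n, tau n.+1] -> f1 t = vpoly (F n) t) /\
  (forall t, t \in `]tau n, tau n.+1[ -> g0 t = vpoly (G n) t).

Let f1F n t : (n < N)%N -> t \in `]tau n, tau n.+1[ -> f1 t = vpoly (F n) t.
Proof. by move=> /FG[fF _] tn; apply: fF; exact: subset_itv_oo_cc. Qed.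

Let itv_in n t : (n < N)%N -> t \in `[tau n, tau n.+1] -> t \in `[0, tau N].
Proof.
move=> nN; rewrite !in_itv/= => /andP[nt tn]; rewrite -tau0.
by rewrite (le_trans _ nt) ?(le_trans tn)// (grid_le tauS)// ltnW.
Qed.

Let node_in n : (n < N)%N -> tau n \in `[tau n, tau n.+1].
Proof. by move=> nN; rewrite in_itv/= lexx ltW// tauS. Qed.

Let node_inS n : (n < N)%N -> tau n.+1 \in `[tau n, tau n.+1].
Proof. by move=> nN; rewrite in_itv/= lexx ltW// tauS. Qed.

Lemma solution_disp U P : sol U P ->
  forall t, t \in `[0, tau N] -> Vh (U t) /\ U t = A (f1 t) + D (P t).
Proof.
move=> [[pU [cU _ _]] _ [U0 P0] E1 _].
have [uc ucE] := pwpoly_closed_pieces tau0 tauS pU cU.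
move=> t tN; have [n nN tn] := grid_cover tau0 N_gt0 tN.
have [Vuc Uc] := ucE n nN.
have VU : Vh (U t) by rewrite Uc//; exact: fin_dim_vpoly.
split => //; have [t0|t0] := eqVneq t 0.
  by rewrite t0 U0 P0; exact: initial_disp.
apply: disp_unique => // v Vv; apply: E1 => //.
by move: tN; rewrite in_itv/= => /andP[? ->]; rewrite lt_neqAle eq_sym t0 andbT.
Qed.

Lemma solution_pressure U P : sol U P -> exists pc : nat -> 'I_m.+2 -> Q,
  forall n, (n < N)%N -> [/\ forall i, Qh (pc n i),
    forall t, t \in `[tau n, tau n.+1] -> P t = vpoly (pc n) t &
    weak_eq (F n) (G n) n (fun i => pc n (lift ord0 i)) (P (tau n))].
Proof.
move=> sUP; have UE := solution_disp sUP; move: sUP => [_ [pP [cP P2 _]] _ _ E2].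
have [pc pcE] := pwpoly_closed_pieces tau0 tauS pP cP.
exists pc => n nN; have [Qpc Pc] := pcE n nN; split => // j z Qz.
rewrite (Pc (tau n))//; last exact: node_in.
move: j; apply/(pressure_equation_weak a_ell k_bnd Vh_fin tau0 tauS (P := P) (U := U)
  (f1 := f1) (g0 := g0)) => //.
- by move=> t tn; apply: Pc; exact: subset_itv_oo_cc.
- move=> t tn; have [_ //] := UE t (itv_in nN (subset_itv_oo_cc tn)).
- by move=> t; exact: f1F.
- by case: (FG nN).
- by move=> t tn; exact: (E2 n nN t tn z Qz).
Qed.

Lemma weak_eq_unique n (p p' : 'I_m.+1 -> Q) p0 : (n < N)%N ->
  (forall i, Qh (p i)) -> (forall i, Qh (p' i)) ->
  weak_eq (F n) (G n) n p p0 -> weak_eq (F n) (G n) n p' p0 -> p =1 p'.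
Proof.
move=> nN Qp Qp' pE p'E i; apply/eqP; rewrite -subr_eq0; apply/eqP; move: i.
apply: (step_form_eq0 Qh_fin cl cr kl kr c_ge0 schur_eq0 k_sym k_ge0 (tauS nN)).
  by move=> i; exact: fin_dimB.
move=> j z Qz; rewrite -[RHS](subrr (pressure_load emb a k b Vh tau n (F n) (G n) p0 j z)).
rewrite -{1}pE// -p'E// /step_form -sumrB; apply: eq_bigr => i _.
by rewrite (scalarB _ _ (cl z)) (scalarB _ _ (kl z)); ring.
Qed.

Lemma weak_eq_exists n p0 : (n < N)%N -> exists p : 'I_m.+1 -> Q,
  (forall i, Qh (p i)) /\ weak_eq (F n) (G n) n p p0.
Proof.
move=> nN; apply: (step_form_exists Qh_fin cl cr kl kr c_ge0 schur_eq0 k_sym k_ge0 (tauS nN)).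
by move=> j; exact: pressure_load_scalar.
Qed.

(** On each time interval the weak pressure equation determines the pressure
    from its value at the left node. *)
Lemma solution_unique U P U' P' : sol U P -> sol U' P' ->
  forall t, t \in `[0, tau N] -> U' t = U t /\ P' t = P t.
Proof.
move=> s s'; have [pc pcE] := solution_pressure s.
have [pc' pcE'] := solution_pressure s'.
have step n : (n < N)%N -> P' (tau n) = P (tau n) ->
    forall t, t \in `[tau n, tau n.+1] -> P' t = P t.
  move=> nN Pn t tn; have [Qp Pp wp] := pcE n nN; have [Qp' Pp' wp'] := pcE' n nN.
  rewrite Pn in wp'.
  rewrite Pp// Pp'// [LHS](vpoly_startE (tau n)) [RHS](vpoly_startE (tau n)).
  rewrite -Pp ?node_in// -Pp' ?node_in// Pn; congr (_ + _).
  by apply: eq_bigr => i _; rewrite (weak_eq_unique nN _ _ wp' wp).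
have nodes n : (n <= N)%N -> P' (tau n) = P (tau n).
  elim: n => [_|n IH nN].
    by rewrite tau0; move: s s' => [_ _ [_ ->] _ _] [_ _ [_ ->] _ _].
  by apply: (step n nN (IH (ltnW nN))); exact: node_inS.
move=> t tN; have [n nN tn] := grid_cover tau0 N_gt0 tN.
have PP : P' t = P t by apply: (step n) => //; exact/nodes/ltnW.
split => //; have [_ ->] := solution_disp s tN; have [_ ->] := solution_disp s' tN.
by rewrite PP.
Qed.

(** March through the grid, solving each interval from the final pressure of the
    previous one, and recover the displacement from the pressure. *)
Lemma solution_exists : exists U P, sol U P.
Proof.
have /choice[s sE] : forall np : nat * Q, exists p : 'I_m.+1 -> Q, (np.1 < N)%N ->
    (forall i, Qh (p i)) /\ weak_eq (F np.1) (G np.1) np.1 p np.2.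
  move=> [n p0] /=; have [nN|_] := ltnP n N; last by exists (fun=> 0).
  by have [p pE] := weak_eq_exists p0 nN; exists p.
pose start := nat_rect (fun=> Q) ph0
  (fun n p0 => vpoly (startcoef (tau n) p0 (s (n, p0))) (tau n.+1)).
pose pc n := startcoef (tau n) (start n) (s (n, start n)).
have pc_start n : vpoly (pc n) (tau n) = start n.
  by rewrite vpoly_startcoef big1 ?addr0// => j _; rewrite subrr scale0r.
have pc_lift n i : pc n (lift ord0 i) = s (n, start n) i.
  by rewrite /pc /startcoef liftK.
have Qs n : (n < N)%N -> (forall i, Qh (s (n, start n) i)).
  by move=> nN; case: (sE (n, start n) nN).
have Qstart n : (n <= N)%N -> Qh (start n).
  elim: n => [//|n IH nN] /=; rewrite vpoly_startcoef.
  apply: fin_dimD => //; first exact/IH/ltnW.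
  by apply: fin_dim_sum => // i; exact: Qs.
have Qpc n i : (n < N)%N -> Qh (pc n i).
  move=> nN; rewrite /pc /startcoef; case: unliftP => [j _|_]; first exact: Qs.
  apply: fin_dimB => //; first exact/Qstart/ltnW.
  by apply: fin_dim_sum => // j; exact: Qs.
have [P Pc] : exists P, forall n, (n < N)%N ->
    forall t, t \in `[tau n, tau n.+1] -> P t = vpoly (pc n) t.
  by apply: (glue_vpoly tauS) => n nN; rewrite [RHS]pc_start.
pose U t := A (f1 t) + D (P t).
pose uc n i := A (F n i) + D (pc n i).
have Uc n : (n < N)%N -> forall t, t \in `[tau n, tau n.+1] -> U t = vpoly (uc n) t.
  move=> nN t tn; rewrite /U (FG nN).1// (Pc n)//.
  by rewrite (load_disp_vpoly a_ell Vh_fin) (pressure_disp_sum _ _ a_ell Vh_fin) vpolyD.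
have Vuc n i : Vh (uc n i) by case: (dispP (F n i) (pc n i)).
have pP : pwpoly tau N Qh m.+1 P.
  move=> n nN; exists (pc n); split => [i|t tn]; first exact: Qpc.
  by apply: (Pc n) => //; exact: subset_itv_oo_cc.
have pU : pwpoly tau N Vh m.+1 U.
  move=> n nN; exists (uc n); split => // t tn.
  by apply: (Uc n) => //; exact: subset_itv_oo_cc.
have P0 : P 0 = ph0.
  by rewrite -tau0 (Pc 0%N)// ?pc_start// node_in.
exists U, P; split.
- by split => //; exact: pieces_H1 Uc.
- by split => //; exact: pieces_H1 Pc.
- by split => //; rewrite /U P0 -initial_disp.
- by move=> t _ v Vv; have [_] := dispP (f1 t) (P t); apply.
move=> n nN t tn z Qz; move: t tn.
apply/(pressure_equation_weak a_ell k_bnd Vh_fin tau0 tauS (P := P) (U := U)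
  (f1 := f1) (g0 := g0) (pc := pc n) (F := F n) (G := G n)) => //.
- exact: pwpoly_L2 pP.
- by move=> t tn; apply: (Pc n) => //; exact: subset_itv_oo_cc.
- by move=> t; exact: f1F.
- by case: (FG nN).
- move=> j; rewrite pc_start; have [_ /(_ j z Qz) <-] := sE (n, start n) nN.
  by apply: eq_bigr => i _; rewrite pc_lift.
Qed.

(** The displacement equation is tested with U', the pressure equation with P.
    The terms in b cancel, a(U, U') is the derivative of a(U, U) / 2, and the
    integral of k(Pi^0 P, P) is that of k(Pi^0 P, Pi^0 P) by orthogonality. *)
Lemma energy_step U P n : sol U P -> (n < N)%N ->
  let kk t := k (Pi0 tau N m P t) (Pi0 tau N m P t) in
  let fg t := f1 t (derive1 U t) + g0 t (P t) in
  [/\ mu.-integrable `]tau n, tau n.+1[ (EFin \o kk),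
      mu.-integrable `]tau n, tau n.+1[ (EFin \o fg) &
      \int[mu]_(t in `]tau n, tau n.+1[) fg t =
      2^-1 * a (U (tau n.+1)) (U (tau n.+1)) - 2^-1 * a (U (tau n)) (U (tau n)) +
      \int[mu]_(t in `]tau n, tau n.+1[) kk t].
Proof.
move=> s nN kk fg.
have UE := solution_disp s; have [pc /(_ n nN)[Qpc Pc _]] := solution_pressure s.
case: s => [[pU [cU _ _]] [_ [_ P2 _]] _ _ E2].
have [ucs /(_ n nN)] := pwpoly_closed_pieces tau0 tauS pU cU.
set uc := ucs n => -[Vuc Uc]; have xy := tauS nN.
have [pi [_ Ppi']] := pwpoly_Pi0 tau m P nN.
have Ppi t : t \in `]tau n, tau n.+1[ -> Pi0 tau N m P t = vpoly pi t by exact: Ppi'.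
have oc t : t \in `]tau n, tau n.+1[ -> t \in `[tau n, tau n.+1].
  exact: subset_itv_oo_cc.
have dU t : t \in `]tau n, tau n.+1[ -> derive1 U t = vpoly (dcoef uc) t.
  by apply: derive1_eq_vpoly => s /oc; exact: Uc.
pose mon l (i : 'I_l) : {poly R} := 'X^i.
have monE l (X : hilbertType R) (c' : 'I_l -> X) t :
    \sum_i (mon l i).[t] *: c' i = vpoly c' t.
  by apply: eq_bigr => i _; rewrite hornerXn.
pose paa := bpoly a (mon _) uc (mon _) uc.
pose pa := bpoly a (mon _) uc (fun i => (mon m.+2 i)^`()) uc.
pose pkp := bpoly k (mon _) (pc n) (mon _) pi.
pose pkk := bpoly k (mon _) pi (mon _) pi.
have paE : pint (tau n) (tau n.+1) pa =
    2^-1 * a (U (tau n.+1)) (U (tau n.+1)) - 2^-1 * a (U (tau n)) (U (tau n)).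
  have := pint_deriv (tau n) (tau n.+1) paa.
  rewrite deriv_bpoly// linearMn/= !horner_bpoly; try exact: bilinear_scalarl;
    try exact: bilinear_scalarr.
  rewrite !monE -!Uc ?node_in ?node_inS// -/pa => paE.
  by rewrite -[LHS](mulfK (_ : 2 != 0 :> R)) ?pnatr_eq0// mulr_natr paE; ring.
have pkE : pint (tau n) (tau n.+1) pkk = pint (tau n) (tau n.+1) pkp.
  rewrite /pkk /pkp !bpolyE !linear_sum; apply: eq_bigr => j _ /=.
  apply: (Pi0_form_moments k_bnd tau0 tauS P2 nN _ Ppi (pi j) j) => t /oc.
  exact: Pc.
have kkE t : t \in `]tau n, tau n.+1[ -> kk t = pkk.[t].
  move=> tn; rewrite horner_bpoly; [|exact: kl|exact: kr].
  by rewrite monE /kk Ppi.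
have fgE t : t \in `]tau n, tau n.+1[ -> fg t = (pa + pkp).[t].
  move=> tn; rewrite hornerD !horner_bpoly; try exact: bilinear_scalarl;
    try exact: bilinear_scalarr.
  rewrite !monE -vpoly_dcoefE -dU// -(Uc _ (oc _ tn)) -(Pc _ (oc _ tn)) -(Ppi _ tn).
  have [_ Ut] := UE t (itv_in nN (oc _ tn)).
  have VdU : Vh (derive1 U t).
    rewrite dU//; apply: fin_dim_vpoly => // i; exact: fin_dimZ.
  have QP : Qh (P t) by rewrite (Pc _ (oc _ tn)); exact: fin_dim_vpoly.
  have [_ /(_ _ VdU)] := dispP (f1 t) (P t); rewrite -Ut => e1.
  by rewrite /fg -e1 -(E2 n nN t tn _ QP) (k_sym (P t)); ring.
have ip (p : {poly R}) (h : R -> R) :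
    (forall t, t \in `]tau n, tau n.+1[ -> h t = p.[t]) ->
    mu.-integrable `]tau n, tau n.+1[ (EFin \o h) /\
    \int[mu]_(t in `]tau n, tau n.+1[) h t = pint (tau n) (tau n.+1) p.
  move=> hp; split.
    have := integrable_horner (tau n) (tau n.+1) p.
    by apply: eq_integrable => // t /set_mem tn /=; rewrite hp.
  by rewrite -Rintegral_horner//; apply: eq_Rintegral => t /set_mem; exact: hp.
have [ikk kkI] := ip _ _ kkE; have [ifg fgI] := ip _ _ fgE.
by split => //; rewrite fgI kkI linearD/= paE pkE.
Qed.

Lemma energy_identity U P n : sol U P -> (n <= N)%N ->
  2^-1 * a (U (tau n)) (U (tau n)) +
  \int[mu]_(t in `[0, tau n]) k (Pi0 tau N m P t) (Pi0 tau N m P t) =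
  2^-1 * a (U 0) (U 0) +
  \int[mu]_(t in `[0, tau n]) (f1 t (derive1 U t) + g0 t (P t)).
Proof.
move=> s nN.
pose kk t := k (Pi0 tau N m P t) (Pi0 tau N m P t).
pose fg t := f1 t (derive1 U t) + g0 t (P t).
have stepE i (iN : (i < n)%N) := energy_step s (leq_trans iN nN).
have ccE (h : R -> R) : (forall i, (i < n)%N ->
      mu.-integrable `]tau i, tau i.+1[ (EFin \o h)) ->
    \int[mu]_(t in `[0, tau n]) h t =
    \sum_(i < n) \int[mu]_(t in `]tau i, tau i.+1[) h t.
  move=> ih; rewrite -[0 in LHS]tau0 Rintegral_itvoo_itvcc ?(Rintegral_grid tauS nN ih)//.
  exact: (grid_integrable tauS nN ih).
rewrite !ccE; [|by move=> i /stepE[]..].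
under [X in _ = _ + X]eq_bigr => i _.
  have [_ _ ->] := stepE i (ltn_ord i).
  over.
rewrite big_split/= addrA; congr (_ + _).
rewrite -(big_mkord xpredT (fun i => 2^-1 * a (U (tau i.+1)) (U (tau i.+1)) -
  2^-1 * a (U (tau i)) (U (tau i)))) telescope_sumr// tau0.
by rewrite addrC subrK.
Qed.

End data.
End fully_discrete_scheme.

Theorem lemma15 (R : realType) (V Q Q0 : hilbertType R)
    (emb : {linear Q -> Q0})
    (a : {biscalar V})
    (k : {biscalar Q})
    (b : {bilinear V -> Q0 -> R | *%R & *%R})
    (Vh : set V) (Qh : set Q)
    (T : R) (f : R -> dual V) (g : R -> dual Q)
    (u0 uh0 : V) (p0 ph0 : Q)
    (tau : nat -> R) (N q : nat)
    (emb_compact : compact_embedding emb)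
    (A1 : [/\ form_bounded a, form_elliptic a & form_symmetric a])
    (A2 : [/\ form_bounded k, form_elliptic k & form_symmetric k])
    (A3 : exists Cb beta, [/\ 0 < Cb, 0 < beta,
      forall v p, b v p <= Cb * energy_norm a v * `|p| &
      forall p, beta * `|p| <=
        sup [set b v p | v in [set v | energy_norm a v = 1]]])
    (Vh_fin : fin_dim_subspace Vh) (Qh_fin : fin_dim_subspace Qh)
    (A3h : exists beta_h, 0 < beta_h /\ forall ph, Qh ph ->
      beta_h * `|emb ph| <=
        sup [set b vh (emb ph) | vh in [set vh | Vh vh /\ energy_norm a vh = 1]])
    (Q_Q0_norm : forall p, `|emb p| <= energy_norm k p)
    (T_gt0 : 0 < T) (fH1 : H1 T f) (gL2 : L2 T g)
    (u0_init : forall v, a u0 v - b v (emb p0) = f 0 v)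
    (uh0_in : Vh uh0) (ph0_in : Qh ph0)
    (uh0_proj : forall vh, Vh vh -> a (uh0 - u0) vh - b vh (emb (ph0 - p0)) = 0)
    (ph0_proj : forall qh, Qh qh -> k (ph0 - p0) qh = 0)
    (tau_grid : time_grid tau N T) (q_ge1 : (1 <= q)%N) :
  let solution := discrete_solution a k b emb Vh Qh tau N q f g uh0 ph0 in
  (exists U P, solution U P /\
     forall U' P', solution U' P' ->
       forall t, t \in `[0, T] -> U' t = U t /\ P' t = P t) /\
  (forall U P, solution U P -> forall n, (n <= N)%N ->
     2^-1 * a (U (tau n)) (U (tau n)) +
     \int[lebesgue_measure]_(t in `[0, tau n])
        k (Pi0 tau N q.-1 P t) (Pi0 tau N q.-1 P t) =
     2^-1 * a (U 0) (U 0) +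
     \int[lebesgue_measure]_(t in `[0, tau n])
        (Pi1 tau N q f t (derive1 U t) + Pi0 tau N q.-1 g t (P t))).
Proof.
have [_ a_ell a_sym] := A1; have [k_bnd k_ell k_sym] := A2.
have [_ emb_inj] : True /\ injective emb by case: emb_compact.
case: tau_grid fH1 => tau0 tauN tauS; rewrite -tauN => {}fH1.
have N_gt0 : (0 < N)%N.
  by case: (N) tauN => // tauT; move: T_gt0; rewrite -tauT tau0 ltxx.
case: q q_ge1 => // m _.
(* If b(., emb p) vanishes on Vh, the supremum in the inf-sup condition is 0. *)
have b_inj p : Qh p -> (forall v, Vh v -> b v (emb p) = 0) -> p = 0.
  move=> Qp bp; have [beta [beta0 /(_ p Qp)]] := A3h.
  set B := [set b vh (emb p) | vh in _].
  have B0 : sup B <= 0.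
    have [Bne|/set0P/negP/negPn/eqP ->] := pselect (B !=set0); last by rewrite sup0.
    by apply: ge_sup => // _ [v [Vv _] <-]; rewrite bp.
  move=> /le_trans/(_ B0); rewrite pmulr_rle0// normr_le0 => /eqP embp.
  by apply: emb_inj; rewrite embp linear0.
have init v : Vh v -> a uh0 v - b v (emb ph0) = f 0 v.
  move=> Vv; rewrite -u0_init; have := uh0_proj v Vv.
  rewrite linearBl/= linearB linearBr/=; lra.
have [F [G FG]] := data_coefficients m g tau0 tauS N_gt0 fH1.
split=> [|U P s n nN].
  have [U [P s]] := solution_exists a_ell k_bnd k_ell k_sym Vh_fin Qh_fin b_inj
    tau0 tauS N_gt0 fH1 uh0_in ph0_in init FG.
  exists U, P; split => // U' P' s'.
  exact: (solution_unique a_ell k_bnd k_ell k_sym Vh_fin Qh_fin b_inj tau0 tauS N_gt0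
    fH1 uh0_in init FG s s').
exact: (energy_identity a_ell a_sym k_bnd k_sym Vh_fin Qh_fin tau0 tauS N_gt0 fH1
  uh0_in init FG s nN).
Qed.
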